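(* Fix positive integers $n,m$. For each $d\geq 1$ let $W=W_d$ be a complex Wishart matrix of parameters $(dn,dm)$ and let $W^\Gamma=(\mathrm{id}\otimes\mathrm{t})W$ be its partial transpose. Then for every integer $p\geq 1$, $$\lim_{d\to\infty}(\mathbb E\circ \mathrm{tr})\big[(mW^\Gamma)^p\big]=\sum_{\pi\in NC(p)} m^{\#\pi}\,n^{\mathrm{e}(\pi)},$$ where $\#\pi$ is the number of blocks of $\pi$ and $\mathrm{e}(\pi)$ is the number of blocks of $\pi$ of even cardinality.
   Context: A complex Wishart matrix of parameters $(dn,dm)$ is $W=(dm)^{-1}GG^*$, where $G$ is a $dn\times dm$ matrix with i.i.d. standard complex Gaussian $\mathcal N(0,1)$ entries. Identify $M_{dn}(\mathbb C)=M_d(\mathbb C)\otimes M_n(\mathbb C)$ and index entries by pairs $(i,a)$ with $i\in\{1,\dots,d\}$, $a\in\{1,\dots,n\}$; the partial transpose is $W^\Gamma=(\mathrm{id}\otimes \mathrm{t})W$, i.e. $W^\Gamma_{ia,jb}=W_{ib,ja}$ ($\mathrm t$ is transposition on $M_n(\mathbb C)$). $\mathrm{tr}$ is the normalized trace $\mathrm{tr}(A)=(dn)^{-1}\sum_k A_{kk}$ on $M_{dn}(\mathbb C)$. $NC(p)$ is the set of noncrossing partitions of $\{1,\dots,p\}$. *)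

(* Defs.v *)
From mathcomp Require Import all_boot.
From Stdlib Require Import Reals ClassicalEpsilon.

Set Implicit Arguments.
Unset Strict Implicit.
Unset Printing Implicit Defensive.

Definition noncrossing (p : nat) (P : {set {set 'I_p}}) : bool :=
  [forall B1 in P, forall B2 in P, (B1 != B2) ==>
     ~~ [exists a : 'I_p, exists b : 'I_p, exists c : 'I_p, exists d : 'I_p,
          [&& (a < b)%N, (b < c)%N, (c < d)%N, a \in B1, c \in B1,
              b \in B2 & d \in B2]]].

Definition is_NC (p : nat) (P : {set {set 'I_p}}) : bool :=
  partition P [set: 'I_p] && noncrossing P.

Definition even_blocks (p : nat) (P : {set {set 'I_p}}) : nat :=
  #|[set B in P | ~~ odd #|B|]|.

Definition nc_moment (n m p : nat) : nat :=
  \sum_(P : {set {set 'I_p}} | is_NC P) m ^ #|P| * n ^ even_blocks P.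

Local Open Scope R_scope.

Definition Cx := (R * R)%type.
Definition Cadd (z w : Cx) : Cx := (fst z + fst w, snd z + snd w).
Definition Cmul (z w : Cx) : Cx :=
  (fst z * fst w - snd z * snd w, fst z * snd w + snd z * fst w).
Definition Cconj (z : Cx) : Cx := (fst z, - snd z).
Definition Cscale (r : R) (z : Cx) : Cx := (r * fst z, r * snd z).
Definition C0 : Cx := (0, 0).
Definition C1 : Cx := (1, 0).

Fixpoint Csum (N : nat) (f : nat -> Cx) : Cx :=
  match N with
  | O => C0
  | S k => Cadd (Csum k f) (f k)
  end.

Definition cmat := nat -> nat -> Cx.
Definition mmul (N : nat) (A B : cmat) : cmat :=
  fun r s => Csum N (fun u => Cmul (A r u) (B u s)).
Definition mid : cmat := fun r s => if Nat.eqb r s then C1 else C0.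
Fixpoint mpow (N : nat) (A : cmat) (k : nat) : cmat :=
  match k with
  | O => mid
  | S k' => mmul N (mpow N A k') A
  end.
Definition ntr (N : nat) (A : cmat) : Cx :=
  Cscale (/ INR N) (Csum N (fun r => A r r)).

(* The Gaussian matrix G (rows: d*n, columns: d*m) is built from the real
   vector x : nat -> R of i.i.d. standard real Gaussians:
   G_{r,l} = (x_{2(r*cols+l)} + i x_{2(r*cols+l)+1}) / sqrt 2,
   a standard complex Gaussian (E|G_{r,l}|^2 = 1). *)
Definition Gent (x : nat -> R) (cols r l : nat) : Cx :=
  (x (2 * (r * cols + l))%nat / sqrt 2, x (2 * (r * cols + l) + 1)%nat / sqrt 2).

Definition wishart (d n m : nat) (x : nat -> R) : cmat :=
  fun r s => Cscale (/ INR (d * m))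
    (Csum (d * m) (fun l => Cmul (Gent x (d * m) r l) (Cconj (Gent x (d * m) s l)))).

(* Index (i,a), i < d, a < n, is encoded as i*n + a  (M_d ⊗ M_n).
   W^Γ_{(i,a),(j,b)} = W_{(i,b),(j,a)}. *)
Definition partial_transpose (n : nat) (A : cmat) : cmat :=
  fun r s => A (Nat.div r n * n + Nat.modulo s n)%nat
               (Nat.div s n * n + Nat.modulo r n)%nat.

Definition moment_sample (d n m p : nat) (x : nat -> R) : Cx :=
  ntr (d * n)
    (mpow (d * n) (fun r s => Cscale (INR m) (partial_transpose n (wishart d n m x) r s)) p).

(* Riemann integral on [a,b] (0 if g is not Riemann integrable there) *)
Definition Rint (g : R -> R) (a b : R) : R :=
  match excluded_middle_informative (exists pr : Riemann_integrable g a b, True) with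
  | left H => RiemannInt (proj1_sig (constructive_indefinite_description _ H))
  | right _ => 0
  end.

(* improper integral over R: lim_{k -> oo} int_{-k}^{k} g (0 if no limit) *)
Definition Rint_line (g : R -> R) : R :=
  match excluded_middle_informative
          (exists l, Un_cv (fun k => Rint g (- INR k) (INR k)) l) with
  | left H => proj1_sig (constructive_indefinite_description _ H)
  | right _ => 0
  end.

Definition gauss (t : R) : R := exp (- (t * t) / 2) / sqrt (2 * PI).

Definition upd (env : nat -> R) (k : nat) (t : R) : nat -> R :=
  fun j => if Nat.eqb j k then t else env j.

Fixpoint gauss_iter (K : nat) (f : (nat -> R) -> R) (env : nat -> R) : R :=
  match K with
  | O => f env
  | S k => Rint_line (fun t => gauss t * gauss_iter k f (upd env k t))
  end.

Definition gauss_expect (K : nat) (f : (nat -> R) -> R) : R :=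
  gauss_iter K f (fun _ => 0).

(* (E ∘ tr)[(m W^Γ)^p] for W Wishart of parameters (dn, dm): real and
   imaginary parts (the G matrix uses 2*(dn)*(dm) real Gaussians). *)
Definition expected_moment_re (d n m p : nat) : R :=
  gauss_expect (2 * (d * n) * (d * m)) (fun x => fst (moment_sample d n m p x)).
Definition expected_moment_im (d n m p : nat) : R :=
  gauss_expect (2 * (d * n) * (d * m)) (fun x => snd (moment_sample d n m p x)).

(* Main.v *)
(* The Wick formula writes the expected trace as a sum over permutations [s] of
   the [p] factors: with [g] the cycle [k -> k + 1] and [#] the number of cycles,
   the exponent of [d] is [#(s g) + #s - p - 1], the exponent of [m] is [#s] and that of [n] is
   [#(g^-1 s) - 1].  The genus inequality [#(s g) + #s <= p + 1] makes every term
   converge, and only the geodesic permutations, those with equality, survive.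
   Their inverses [t] are exactly the permutations that run increasingly through
   the blocks of a noncrossing partition, and along a geodesic one has
   [#(g t) = 1 + e(t)], because [#(t t) = #t + e(t)] and each transposition
   leading from [t] to [g] joins two cycles on both sides. *)

Require Import Defs.
From Stdlib Require Reals Lra Lia FunctionalExtensionality ClassicalEpsilon.
From Coquelicot Require Coquelicot.

(** * Gaussian integrals on the line *)

Module GaussianLine.
Import Stdlib.Reals.Reals Stdlib.micromega.Lra Stdlib.micromega.Lia FunctionalExtensionality ClassicalEpsilon.
Import Coquelicot.Coquelicot.
Local Open Scope R_scope.

(** The expectation is an iterated improper Riemann integral with default value 0, so linearity
    fails for arbitrary integrands. Only polynomials are ever integrated: written as lists of
    coefficients and words in the real variables, they reduce to explicit one-dimensional moments.
    The result depends on the function alone, so every representation of it may be used. Integration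
    by parts on words, carried to complex Gaussians by multilinearity, gives the Wick recursion.
    Only a Gaussian and its own conjugate are correlated, so this recursion is the row expansion of
    a permanent; hence permutations and not general pairings. In the combinatorial half the genus
    inequality bounds cycles on one side only. That a noncrossing partition yields equality needs a
    lower bound for the cycles of its Kreweras complement, obtained from a function constant on
    these cycles that takes enough values. *)

Definition gauss0 (t : R) : R := exp (- (t * t) / 2).

Lemma continuous_gauss0 x : continuous gauss0 x.
Proof. apply (ex_derive_continuous (V := R_NormedModule)). unfold gauss0. auto_derive. auto. Qed.

Lemma ex_RInt_gauss0 a b : ex_RInt gauss0 a b.
Proof. apply (ex_RInt_continuous (V := R_CompleteNormedModule)). intros; apply continuous_gauss0. Qed.

Lemma is_derive_RInt_gauss0 x : is_derive (fun x => RInt gauss0 0 x) x (gauss0 x).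
Proof.
apply (is_derive_RInt (V := R_NormedModule) gauss0 (fun x => RInt gauss0 0 x) 0 x).
  apply filter_forall; intros y. apply (RInt_correct (V := R_CompleteNormedModule)). apply ex_RInt_gauss0.
apply continuous_gauss0.
Qed.

(** The Gaussian integral is evaluated without double integrals: the square of [RInt gauss0 0 x] and
    the integral of [kern x] over [[0, 1]] have opposite derivatives. The denominator [1 + t * t]
    cancels the factor produced by differentiating in [x]. *)
Definition kern (x t : R) : R := exp (- (x * x) * (1 + t * t) / 2) * (2 / (1 + t * t)).
Definition dkern (x t : R) : R := - 2 * x * exp (- (x * x) * (1 + t * t) / 2).

Lemma one_sqr_pos t : 0 < 1 + t * t.
Proof. nra. Qed.

Lemma is_derive_kern x t : is_derive (fun x => kern x t) x (dkern x t).
Proof.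
unfold kern, dkern. pose proof (one_sqr_pos t).
auto_derive; [lra|]. unfold Rdiv. field. lra.
Qed.

Lemma ex_RInt_kern x a b : ex_RInt (kern x) a b.
Proof.
apply (ex_RInt_continuous (V := R_CompleteNormedModule)). intros t _.
apply (ex_derive_continuous (V := R_NormedModule)). unfold kern. pose proof (one_sqr_pos t). auto_derive. lra.
Qed.

Lemma continuity_2d_dkern x t : continuity_2d_pt dkern x t.
Proof.
unfold dkern.
apply continuity_2d_pt_mult.
  apply continuity_2d_pt_mult. apply continuity_2d_pt_const. apply continuity_2d_pt_id1.
apply (continuity_1d_2d_pt_comp exp (fun u v => - (u * u) * (1 + v * v) / 2)).
  apply derivable_continuous_pt, derivable_pt_exp.
unfold Rdiv. apply continuity_2d_pt_mult; [|apply continuity_2d_pt_const].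
apply continuity_2d_pt_mult.
  apply continuity_2d_pt_opp, continuity_2d_pt_mult; apply continuity_2d_pt_id1.
apply continuity_2d_pt_plus; [apply continuity_2d_pt_const|].
apply continuity_2d_pt_mult; apply continuity_2d_pt_id2.
Qed.

Lemma is_derive_RInt_kern x :
  is_derive (fun x => RInt (kern x) 0 1) x (RInt (dkern x) 0 1).
Proof.
assert (E : forall x t, Derive (fun x => kern x t) x = dkern x t).
  intros; apply is_derive_unique, is_derive_kern.
replace (RInt (dkern x) 0 1) with (RInt (fun t => Derive (fun u => kern u t) x) 0 1).
2: apply RInt_ext; intros; apply E.
apply is_derive_RInt_param.
- apply filter_forall; intros y t _. eexists; apply is_derive_kern.
- intros t _. apply continuity_2d_pt_ext with dkern; [intros; symmetry; apply E|].
  apply continuity_2d_dkern.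
- apply filter_forall; intros y. apply ex_RInt_kern.
Qed.

(** Substitution [u = x * t]; the factor [x] of [dkern] is the Jacobian. *)
Lemma RInt_dkern x : RInt (dkern x) 0 1 = - 2 * gauss0 x * RInt gauss0 0 x.
Proof.
pose proof (RInt_comp_lin (V := R_CompleteNormedModule) gauss0 x 0 0 1 (ex_RInt_gauss0 _ _)) as C.
replace (x * 0 + 0) with 0 in C by ring. replace (x * 1 + 0) with x in C by ring.
rewrite <- C. rewrite <- (RInt_scal (V := R_CompleteNormedModule)).
  apply RInt_ext. intros t _. unfold scal; simpl; unfold mult; simpl. unfold dkern, gauss0.
  replace (- (x * x) * (1 + t * t) / 2) with (- (x * x) / 2 + - ((x * t + 0) * (x * t + 0)) / 2) by field.
  rewrite exp_plus. ring.
apply (ex_RInt_continuous (V := R_CompleteNormedModule)). intros t _.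
apply (ex_derive_continuous (V := R_NormedModule)). unfold scal; simpl; unfold mult; simpl. unfold gauss0. auto_derive. auto.
Qed.

(** The derivative in [x] vanishes, and at [x = 0] the kernel is [2 / (1 + t^2)], with primitive
    [2 atan]. *)
Lemma gauss0_sqr_add_kern x : (RInt gauss0 0 x) ^ 2 + RInt (kern x) 0 1 = PI / 2.
Proof.
assert (D : forall x, is_derive (fun x => (RInt gauss0 0 x) ^ 2 + RInt (kern x) 0 1) x 0).
  intros y. evar_last.
    apply (is_derive_plus (K := R_AbsRing) (V := R_NormedModule) (fun x => (RInt gauss0 0 x) ^ 2)).
      apply (is_derive_pow (fun x => RInt gauss0 0 x) 2). apply is_derive_RInt_gauss0.
    apply is_derive_RInt_kern.
  rewrite RInt_dkern. unfold plus; simpl. ring.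
assert (E0 : (RInt gauss0 0 0) ^ 2 + RInt (kern 0) 0 1 = PI / 2).
  rewrite (RInt_point (V := R_CompleteNormedModule)). unfold zero; simpl.
  assert (I : is_RInt (kern 0) 0 1 (minus (2 * atan 1) (2 * atan 0))).
    apply (is_RInt_derive (V := R_CompleteNormedModule) (fun t => 2 * atan t)).
      intros t _. unfold kern. replace (- (0 * 0) * (1 + t * t) / 2) with 0 by field.
      rewrite exp_0. evar_last. apply is_derive_scal, is_derive_Reals, derivable_pt_lim_atan.
      unfold Rsqr. field. pose proof (one_sqr_pos t); lra.
    intros t _. apply (ex_derive_continuous (V := R_NormedModule)). unfold kern. pose proof (one_sqr_pos t). auto_derive. lra.
  apply (is_RInt_unique (V := R_CompleteNormedModule)) in I. rewrite I.
  rewrite atan_1, atan_0. unfold minus, plus, opp; simpl. field.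
destruct (Req_dec x 0) as [->|nx]; [exact E0|]. rewrite <- E0.
destruct (MVT_gen (fun x => (RInt gauss0 0 x) ^ 2 + RInt (kern x) 0 1) 0 x (fun _ => 0)) as [c [_ E]].
- intros; apply D.
- intros y _. apply derivable_continuous_pt. exists 0. apply is_derive_Reals, D.
- lra.
Qed.

Lemma RInt_kern_bound x : 0 <= RInt (kern x) 0 1 <= 2 * gauss0 x.
Proof.
assert (P : forall t, 0 < 2 / (1 + t * t) <= 2).
  intros t. pose proof (one_sqr_pos t). split.
    apply Rdiv_lt_0_compat; lra.
  apply Rmult_le_reg_r with (1 + t * t); [lra|]. unfold Rdiv. rewrite Rmult_assoc, Rinv_l by lra. nra.
split.
  apply RInt_ge_0; [lra|apply ex_RInt_kern|]. intros t _. unfold kern.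
  apply Rmult_le_pos; [apply Rlt_le, exp_pos|apply Rlt_le, P].
replace (2 * gauss0 x) with (RInt (fun _ => 2 * gauss0 x) 0 1).
2: { rewrite RInt_const. unfold scal; simpl; unfold mult; simpl. ring. }
apply RInt_le; [lra|apply ex_RInt_kern|apply ex_RInt_const|].
intros t _. unfold kern, gauss0. rewrite (Rmult_comm 2).
apply Rmult_le_compat; [apply Rlt_le, exp_pos|apply Rlt_le, P| |apply P].
assert (L : - (x * x) * (1 + t * t) / 2 <= - (x * x) / 2).
  pose proof (Rle_0_sqr (x * t)) as S. unfold Rsqr in S. nra.
destruct L as [L|L]; [apply Rlt_le, exp_increasing, L|rewrite L; apply Rle_refl].
Qed.

(* From the [k.+1]-st Taylor term of [exp (x^2 / 2)]. *)
Lemma pow_gauss0_bound k : exists C, forall x, 1 <= x -> x ^ k * gauss0 x <= C / x.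
Proof.
exists (2 ^ (S k) * INR (Factorial.fact (S k))). intros x hx.
set (y := x * x / 2).
assert (hy : 0 <= y) by (unfold y; nra).
pose proof (exp_ge_taylor y (S k) hy) as T.
assert (F : 0 < INR (Factorial.fact (S k))) by apply INR_fact_lt_0.
assert (T2 : y ^ S k / INR (Factorial.fact (S k)) <= exp y).
  refine (Rle_trans _ _ _ _ T). rewrite tech5.
  assert (0 <= sum_f_R0 (fun k0 => y ^ k0 / INR (Factorial.fact k0)) k); [|lra].
  apply cond_pos_sum. intros j. apply Rmult_le_pos; [apply pow_le, hy|].
  apply Rlt_le, Rinv_0_lt_compat, INR_fact_lt_0.
assert (G : gauss0 x = / exp y).
  unfold gauss0, y. rewrite <- exp_Ropp. f_equal. field.
assert (xp : x ^ (2 * S k) = 2 ^ S k * y ^ S k).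
  rewrite pow_mult, <- Rpow_mult_distr. f_equal. unfold y. simpl. field.
assert (Y : x ^ (2 * S k) <= 2 ^ S k * INR (Factorial.fact (S k)) * exp y).
  rewrite xp, Rmult_assoc. apply Rmult_le_compat_l; [apply pow_le; lra|].
  apply (Rmult_le_compat_l (INR (Factorial.fact (S k)))) in T2; [|lra].
  replace (INR (Factorial.fact (S k)) * (y ^ S k / INR (Factorial.fact (S k)))) with (y ^ S k) in T2; [exact T2|field; lra].
pose proof (exp_pos y) as ey. rewrite G.
apply Rmult_le_reg_r with (x * exp y); [nra|].
replace (x ^ k * / exp y * (x * exp y)) with (x ^ S k) by (simpl; field; lra).
replace (2 ^ S k * INR (Factorial.fact (S k)) / x * (x * exp y)) with (2 ^ S k * INR (Factorial.fact (S k)) * exp y) by (field; lra).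
refine (Rle_trans _ _ _ _ Y). apply Rle_pow; [exact hx|lia].
Qed.

Lemma Un_cv_pow_gauss0 k : Un_cv (fun N => INR N ^ k * gauss0 (INR N)) 0.
Proof.
destruct (pow_gauss0_bound k) as [C HC].
apply is_lim_seq_Reals.
apply is_lim_seq_le_le_loc with (fun _ => 0) (fun N => C * / INR N).
- exists 1%nat. intros N hN. apply le_INR in hN. simpl in hN. split; [|apply HC, hN].
  apply Rmult_le_pos; [apply pow_le; lra|apply Rlt_le, exp_pos].
- apply is_lim_seq_const.
- replace (Finite 0) with (Rbar_mult (Finite C) (Finite 0)) by (simpl; f_equal; ring).
  apply is_lim_seq_scal_l.
  replace (Finite 0) with (Rbar_inv p_infty) by reflexivity.
  apply is_lim_seq_inv; [apply is_lim_seq_INR|discriminate].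
Qed.

Lemma gauss0_even x : gauss0 (- x) = gauss0 x.
Proof. unfold gauss0. f_equal. field. Qed.

Lemma RInt_gauss0_sym x : RInt gauss0 (- x) x = 2 * RInt gauss0 0 x.
Proof.
rewrite <- (RInt_Chasles (V := R_CompleteNormedModule) gauss0 (- x) 0 x) by apply ex_RInt_gauss0.
replace (RInt gauss0 (- x) 0) with (RInt gauss0 0 x).
  unfold plus; simpl. ring.
pose proof (RInt_comp_lin (V := R_CompleteNormedModule) gauss0 (-1) 0 0 x (ex_RInt_gauss0 _ _)) as C.
replace (-1 * 0 + 0) with 0 in C by ring. replace (-1 * x + 0) with (- x) in C by ring.
rewrite <- (opp_RInt_swap (V := R_CompleteNormedModule) gauss0 0 (- x)) by apply ex_RInt_gauss0. rewrite <- C.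
rewrite (RInt_ext (fun y => scal (-1) (gauss0 (-1 * y + 0))) (fun y => opp (gauss0 y))).
  rewrite (RInt_opp (V := R_CompleteNormedModule)) by apply ex_RInt_gauss0.
  unfold opp; simpl. rewrite Ropp_involutive. reflexivity.
intros y _. replace (-1 * y + 0) with (- y) by ring. rewrite gauss0_even.
unfold scal, opp; simpl; unfold mult; simpl. ring.
Qed.

Lemma Un_cv_RInt_gauss0 : Un_cv (fun N => RInt gauss0 (- INR N) (INR N)) (sqrt (2 * PI)).
Proof.
apply is_lim_seq_Reals.
apply is_lim_seq_ext with (fun N => 2 * sqrt (PI / 2 - RInt (kern (INR N)) 0 1)).
  intros N. rewrite RInt_gauss0_sym. f_equal.
  rewrite <- (gauss0_sqr_add_kern (INR N)).
  match goal with |- sqrt ?a = _ => replace a with ((RInt gauss0 0 (INR N)) ^ 2) by ring end.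
  rewrite <- Rsqr_pow2. apply sqrt_Rsqr. apply RInt_ge_0; [apply pos_INR|apply ex_RInt_gauss0|].
  intros; apply Rlt_le, exp_pos.
replace (sqrt (2 * PI)) with (2 * sqrt (PI / 2 - 0)).
2: { rewrite Rminus_0_r. replace (2 * PI) with ((2 * 2) * (PI / 2)) by field.
     rewrite sqrt_mult, sqrt_square; try lra. pose proof PI_RGT_0; lra. }
apply (is_lim_seq_scal_l _ 2 (sqrt (PI / 2 - 0))).
apply (is_lim_seq_continuous sqrt).
  apply continuity_pt_sqrt. pose proof PI_RGT_0; lra.
apply (is_lim_seq_minus' (fun _ => PI / 2)); [apply is_lim_seq_const|].
apply is_lim_seq_le_le with (fun _ => 0) (fun N => 2 * (INR N ^ 0 * gauss0 (INR N))).
- intros N. simpl. rewrite Rmult_1_l. apply RInt_kern_bound.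
- apply is_lim_seq_const.
- replace (Finite 0) with (Rbar_mult (Finite 2) (Finite 0)) by (simpl; f_equal; ring).
  apply is_lim_seq_scal_l. apply is_lim_seq_Reals, Un_cv_pow_gauss0.
Qed.

(** Integrability on all segments is carried along with the limit: without it [Rint] falls back to 0
    and linearity is lost. *)
Definition line_integral (g : R -> R) (l : R) : Prop :=
  (forall a b, ex_RInt g a b) /\ Un_cv (fun N => RInt g (- INR N) (INR N)) l.

Lemma Rint_RInt g a b : ex_RInt g a b -> Rint g a b = RInt g a b.
Proof.
intros H. unfold Rint. destruct (excluded_middle_informative _) as [E|E].
  symmetry; apply RInt_Reals.
exfalso; apply E. exists (ex_RInt_Reals_0 _ _ _ H). exact I.
Qed.

Lemma Rint_line_eq g l : line_integral g l -> Rint_line g = l.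
Proof.
intros [ex cv].
assert (cv' : Un_cv (fun k => Rint g (- INR k) (INR k)) l).
  apply Un_cv_ext with (2 := cv). intros k; symmetry; apply Rint_RInt, ex.
unfold Rint_line. destruct (excluded_middle_informative _) as [E|E].
  destruct (constructive_indefinite_description _ E) as [l' cv2]; simpl.
  apply UL_sequence with (1 := cv2), cv'.
exfalso; apply E. exists l; exact cv'.
Qed.

Lemma line_integral_ext f g l : (forall t, f t = g t) -> line_integral f l -> line_integral g l.
Proof. intros E; replace g with f; [trivial|]. apply functional_extensionality, E. Qed.

Lemma line_integral_0 : line_integral (fun _ => 0) 0.
Proof.
split; [intros; apply ex_RInt_const|].
apply Un_cv_ext with (fun _ => 0).
  intros N. rewrite RInt_const. unfold scal; simpl; unfold mult; simpl. ring.
apply is_lim_seq_Reals, is_lim_seq_const.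
Qed.

Lemma line_integral_plus f g l k : line_integral f l -> line_integral g k ->
  line_integral (fun t => f t + g t) (l + k).
Proof.
intros [ef cf] [eg cg]; split; [intros; apply (ex_RInt_plus (V := R_NormedModule)); auto|].
apply Un_cv_ext with (fun N => RInt f (- INR N) (INR N) + RInt g (- INR N) (INR N)).
  intros N. symmetry; apply (RInt_plus (V := R_CompleteNormedModule)); auto.
apply CV_plus; assumption.
Qed.

Lemma line_integral_scal c f l : line_integral f l -> line_integral (fun t => c * f t) (c * l).
Proof.
intros [ef cf]; split; [intros; apply (ex_RInt_scal (V := R_NormedModule)); auto|].
apply Un_cv_ext with (fun N => c * RInt f (- INR N) (INR N)).
  intros N. symmetry; apply (RInt_scal (V := R_CompleteNormedModule)); auto.
apply is_lim_seq_Reals, (is_lim_seq_scal_l _ c l), is_lim_seq_Reals, cf.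
Qed.

Lemma line_integral_derive f df : (forall t, is_derive f t (df t)) -> (forall t, continuous df t) ->
  Un_cv (fun N => f (INR N) - f (- INR N)) 0 -> line_integral df 0.
Proof.
intros D C L.
assert (I : forall a b, is_RInt df a b (f b - f a)).
  intros a b. apply (is_RInt_derive (V := R_CompleteNormedModule)); intros; auto.
split; [intros a b; eexists; apply I|].
apply Un_cv_ext with (2 := L). intros N. symmetry.
apply (is_RInt_unique (V := R_CompleteNormedModule)), I.
Qed.

(** The standard normal moments: [(k - 1)!!] for even [k] and 0 for odd [k]. *)
Fixpoint gauss_moment (k : nat) : R :=
  match k with
  | O => 1
  | S k1 => match k1 with O => 0 | S k2 => INR k1 * gauss_moment k2 end
  end.

Lemma Un_cv_opp_pow_gauss0 k : Un_cv (fun N => (- INR N) ^ k * gauss0 (- INR N)) 0.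
Proof.
apply Un_cv_ext with (fun N => (-1) ^ k * (INR N ^ k * gauss0 (INR N))).
  intros N. rewrite gauss0_even. replace (- INR N) with (-1 * INR N) by ring.
  rewrite Rpow_mult_distr. ring.
replace 0 with ((-1) ^ k * 0) by ring.
apply is_lim_seq_Reals, (is_lim_seq_scal_l _ ((-1) ^ k) 0), is_lim_seq_Reals, Un_cv_pow_gauss0.
Qed.

Lemma Un_cv_boundary k c :
  Un_cv (fun N => c * (INR N ^ k * gauss0 (INR N)) - c * ((- INR N) ^ k * gauss0 (- INR N))) 0.
Proof.
replace 0 with (c * 0 - c * 0) by ring.
apply CV_minus; apply is_lim_seq_Reals, (is_lim_seq_scal_l _ c 0), is_lim_seq_Reals;
  [apply Un_cv_pow_gauss0|apply Un_cv_opp_pow_gauss0].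
Qed.

Lemma continuous_pow_gauss0 a b k j t :
  continuous (fun t => a * (t ^ k * gauss0 t) + b * (t ^ j * gauss0 t)) t.
Proof. apply (ex_derive_continuous (V := R_NormedModule)). unfold gauss0. auto_derive. auto. Qed.

Lemma line_integral_gauss0_moment k :
  line_integral (fun t => t ^ k * gauss0 t) (sqrt (2 * PI) * gauss_moment k).
Proof.
(* The recursion descends by two, so two consecutive moments are proved together. *)
enough (H : line_integral (fun t => t ^ k * gauss0 t) (sqrt (2 * PI) * gauss_moment k) /\
  line_integral (fun t => t ^ S k * gauss0 t) (sqrt (2 * PI) * gauss_moment (S k))) by apply H.
induction k as [|k [IH1 IH2]].
  split.
    simpl. rewrite Rmult_1_r. apply line_integral_ext with gauss0; [intros; ring|].
    split; [apply ex_RInt_gauss0|apply Un_cv_RInt_gauss0].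
  replace (sqrt (2 * PI) * gauss_moment 1) with 0 by (simpl; ring).
  apply line_integral_derive with (fun t => -1 * (t ^ 0 * gauss0 t)).
  - intros t; change R in t. unfold gauss0. auto_derive; [auto|]. simpl. unfold Rdiv. field.
  - intros t. eapply continuous_ext; [|apply (continuous_pow_gauss0 1 0 1 0)]. intros; simpl; ring.
  - apply Un_cv_boundary.
split; [exact IH2|].
(* Integration by parts: the integrand is the derivative of [t^(k+1) * gauss0 t], whose boundary
   values tend to 0. *)
assert (D : line_integral (fun t => -1 * (t ^ S (S k) * gauss0 t) + INR (S k) * (t ^ k * gauss0 t)) 0).
  apply line_integral_derive with (fun t => 1 * (t ^ S k * gauss0 t)).
  - intros t; change R in t. unfold gauss0. auto_derive; [auto|]. change (Init.Nat.pred (S k)) with k. unfold Rdiv. rewrite <- !tech_pow_Rmult. change (match k with O => 1 | S _ => INR k + 1 end) with (INR (S k)). field.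
  - intros t. apply continuous_pow_gauss0.
  - apply Un_cv_boundary.
pose proof (line_integral_plus _ _ _ _ (line_integral_scal (INR (S k)) _ _ IH1)
  (line_integral_scal (-1) _ _ D)) as E.
replace (sqrt (2 * PI) * gauss_moment (S (S k)))
  with (INR (S k) * (sqrt (2 * PI) * gauss_moment k) + -1 * 0).
  refine (line_integral_ext _ _ _ _ E). intros; simpl; ring.
change (gauss_moment (S (S k))) with (INR (S k) * gauss_moment k). ring.
Qed.

Lemma line_integral_gauss_moment k : line_integral (fun t => gauss t * t ^ k) (gauss_moment k).
Proof.
assert (S0 : 0 < sqrt (2 * PI)) by (apply sqrt_lt_R0; pose proof PI_RGT_0; lra).
pose proof (line_integral_scal (/ sqrt (2 * PI)) _ _ (line_integral_gauss0_moment k)) as E.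
replace (gauss_moment k) with (/ sqrt (2 * PI) * (sqrt (2 * PI) * gauss_moment k)) by (field; lra).
refine (line_integral_ext _ _ _ _ E). intros t; unfold gauss, gauss0; field; lra.
Qed.

(** Kills the terms with strict genus inequality; [S k] is the dimension [d], which starts at 1. *)
Lemma Un_cv_pow_ratio e N : (e < N)%nat -> Un_cv (fun k => INR (S k) ^ e / INR (S k) ^ N) 0.
Proof.
intros lt. apply is_lim_seq_Reals.
apply is_lim_seq_le_le with (fun _ => 0) (fun k => / INR (S k)).
- intros k. assert (h : 1 <= INR (S k)) by (rewrite S_INR; pose proof (pos_INR k); lra).
  assert (he : 0 < INR (S k) ^ e) by (apply pow_lt; lra).
  replace N with (e + (1 + (N - e - 1)))%nat by lia. rewrite !pow_add, pow_1.
  set (a := INR (S k) ^ (N - e - 1)). assert (ha : 1 <= a) by (apply pow_R1_Rle; exact h).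
  replace (INR (S k) ^ e / (INR (S k) ^ e * (INR (S k) * a))) with (/ INR (S k) * / a) by (field; lra).
  assert (0 < / INR (S k)) by (apply Rinv_0_lt_compat; lra).
  assert (0 < / a) by (apply Rinv_0_lt_compat; lra).
  assert (/ a <= 1) by (rewrite <- Rinv_1; apply Rinv_le_contravar; lra).
  split; nra.
- apply is_lim_seq_const.
- apply (is_lim_seq_incr_1 (fun k => / INR k)).
  replace (Finite 0) with (Rbar_inv p_infty) by reflexivity.
  apply is_lim_seq_inv; [apply is_lim_seq_INR|discriminate].
Qed.

Lemma Un_cv_const c : Un_cv (fun _ => c) c.
Proof. apply is_lim_seq_Reals, is_lim_seq_const. Qed.

End GaussianLine.

From mathcomp Require Import all_boot all_fingroup.
From mathcomp Require Import zify.

Set Implicit Arguments.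
Unset Strict Implicit.
Unset Printing Implicit Defensive.

(** * Geodesic permutations and noncrossing partitions *)

Module GeodesicPermutations.
Import GroupScope.

(** * The genus inequality and geodesics *)

Section Genus.
Variable T : finType.
Implicit Types (s t a b g k : {perm T}) (x y z : T).

Definition ncycles s := #|porbits s|.

Lemma ncycles_tperm_split s x y : x \in porbit s y -> x != y ->
  ncycles (tperm x y * s) = (ncycles s).+1.
Proof.
by move=> xy nxy; have := porbits_mul_tperm s x y; rewrite /= xy nxy addn0 addn1.
Qed.

Lemma ncycles_tperm_join s x y : x \notin porbit s y ->
  ncycles s = (ncycles (tperm x y * s)).+1.
Proof.
move=> xy; have := porbits_mul_tperm s x y; rewrite /= xy.
have -> : x != y by apply: contraNneq xy => ->; apply: porbit_id.
by rewrite doubleS double0 addn2 addn1 => -[].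
Qed.

Lemma ncycles_tperm_le s x y : ncycles (tperm x y * s) <= (ncycles s).+1.
Proof.
have := porbits_mul_tperm s x y; rewrite /= -/(ncycles _) => E.
by apply: (@leq_trans (ncycles s + (x != y))); [rewrite -E leq_addr | case: (x != y); lia].
Qed.

Lemma ncycles_tperm_ge s x y : ncycles s <= (ncycles (tperm x y * s)).+1.
Proof. by rewrite -{1}[s]mul1g -(tperm2 x y) -mulgA ncycles_tperm_le. Qed.

Lemma porbit1 x : porbit (1 : {perm T}) x = [set x].
Proof.
apply/setP => y; rewrite inE; apply/porbitP/eqP => [[i ->]|->].
  by rewrite expg1n perm1.
by exists 0; rewrite expg0 perm1.
Qed.

Lemma ncycles1 : ncycles (1 : {perm T}) = #|T|.
Proof.
rewrite /ncycles /porbits card_imset // => x y; rewrite !porbit1 => /set1_inj; exact.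
Qed.

Lemma ncycles_max s : ncycles s <= #|T|.
Proof. exact: leq_imset_card. Qed.

Lemma ncyclesV s : ncycles s^-1 = ncycles s.
Proof. by rewrite /ncycles porbitsV. Qed.

Lemma porbit_closed s (A : {pred T}) : (forall x, x \in A -> s x \in A) ->
  forall x y, x \in A -> y \in porbit s x -> y \in A.
Proof.
move=> cl x y xA /porbitP [i ->]; elim: i => [|i IH]; first by rewrite expg0 perm1.
by rewrite expgSr permM; apply: cl.
Qed.

Lemma porbit_step s x : porbit s (s x) = porbit s x.
Proof. by rewrite -(porbit_perm s 1 x) expg1. Qed.

Lemma mem_porbit_step s x y : (s x \in porbit s y) = (x \in porbit s y).
Proof. by rewrite porbit_sym porbit_step porbit_sym. Qed.

Lemma porbitJ s t x : porbit (s ^ t) (t x) = t @: porbit s x.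
Proof.
apply/setP => y; apply/porbitP/imsetP => [[i ->]|[z /porbitP [i ->] ->]].
  exists ((s ^+ i) x); first exact: mem_porbit.
  by rewrite -conjXg /conjg !permM permK.
by exists i; rewrite -conjXg /conjg !permM permK.
Qed.

Lemma ncyclesJ s t : ncycles (s ^ t) = ncycles s.
Proof.
rewrite /ncycles; have -> : porbits (s ^ t) = (fun A : {set T} => t @: A) @: porbits s.
  apply/setP => B; apply/imsetP/imsetP => [[x _ ->]|[A /imsetP [x _ ->] ->]].
    exists (porbit s (t^-1 x)); first exact: imset_f.
    by rewrite -porbitJ permKV.
  by exists (t x); rewrite ?porbitJ.
by rewrite card_imset //; apply: imset_inj; apply: perm_inj.
Qed.

Lemma ncyclesC a b : ncycles (a * b) = ncycles (b * a).
Proof. by rewrite -(ncyclesJ (b * a) b) /conjg !mulgA mulVg mul1g. Qed.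

Lemma porbit_move s x : s x != x ->
  ncycles (tperm x (s x) * s) = (ncycles s).+1.
Proof.
move=> sx; apply: ncycles_tperm_split; last by rewrite eq_sym.
by rewrite porbit_sym mem_porbit_step porbit_id.
Qed.

Lemma perm_moves s : s != 1 -> exists x, s x != x.
Proof.
move=> s1; apply/existsP; apply: contraNT s1 => /existsPn h.
by apply/eqP/permP => x; rewrite perm1; apply/eqP; move: (h x); rewrite negbK.
Qed.

(** [tperm x (s x) * s] fixes [s x] and has one cycle more than [s]. Since there are at most [#|T|]
    cycles, repeated splitting ends at the identity. *)
Lemma perm_split_ind (P : {perm T} -> Prop) :
  P 1 -> (forall s x, s x != x -> P (tperm x (s x) * s) -> P s) -> forall s, P s.
Proof.
move=> P1 PS s; have [N] := ubnP (#|T| - ncycles s).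
elim: N s => // N IH s leN.
have [->//|s1] := eqVneq s 1; have [x sx] := perm_moves s1.
apply: (PS _ x sx); apply: IH.
have := ncycles_max (tperm x (s x) * s); rewrite porbit_move // => le2.
by apply: leq_trans (_ : #|T| - ncycles s <= N); rewrite ?ltn_sub2l.
Qed.

(** Triangle inequality for the transposition length [#|T| - ncycles s]: a split adds one cycle to
    [a] and at most one to [a * b]. *)
Lemma ncycles_genus a b : ncycles a + ncycles b <= #|T| + ncycles (a * b).
Proof.
elim/perm_split_ind: a => [|a x ax IH]; first by rewrite ncycles1 mul1g.
rewrite -ltnS -addSn -(porbit_move ax); apply: leq_trans IH _.
by rewrite -addnS leq_add2l -mulgA ncycles_tperm_le.
Qed.

(** Says that [a] lies on a shortest path from [1] to [a * b] in the Cayley graph of the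
    transpositions. *)
Definition geodesic a b := ncycles a + ncycles b == #|T| + ncycles (a * b).

(** The split raises the left side of an equality in [ncycles_genus] by one, so the right side has
    to follow. *)
Lemma geodesic_split a b x y : geodesic a b -> x \in porbit a y -> x != y ->
  geodesic (tperm x y * a) b /\ ncycles (tperm x y * (a * b)) = (ncycles (a * b)).+1.
Proof.
move=> /eqP g xy nxy; have E := ncycles_tperm_split xy nxy.
have := ncycles_genus (tperm x y * a) b; rewrite E addSn g -mulgA -addnS leq_add2l => le1.
have E2 : ncycles (tperm x y * (a * b)) = (ncycles (a * b)).+1.
  by apply/eqP; rewrite eqn_leq le1 ncycles_tperm_le.
by split=> //; apply/eqP; rewrite -mulgA E E2 addSn g addnS.
Qed.

(** Otherwise the transposition of [x] and [y] would join two cycles of [a * b], while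
    [geodesic_split] says that it splits one. *)
Lemma geodesic_porbit a b x y : geodesic a b -> x \in porbit a y -> x \in porbit (a * b) y.
Proof.
move=> g xy; have [->|nxy] := eqVneq x y; first exact: porbit_id.
have [_ E] := geodesic_split g xy nxy; apply: contraPT (ncycles_tperm_join (s:=a*b) (x:=x) (y:=y)) => h.
by move=> /(_ h); rewrite E; lia.
Qed.

(* Splitting the cycles of [k] one transposition at a time reduces to [k = 1]. *)
Lemma ncycles_geodesic_mul a k : geodesic a k ->
  ncycles (a * k * a) + ncycles a = ncycles (a * a) + ncycles (a * k).
Proof.
move: k; elim/perm_split_ind => [|k x kx IH] g; first by rewrite mulg1.
set k' := tperm x (k x) * k in IH.
have Ek' : ncycles k' = (ncycles k).+1 by rewrite /k' porbit_move.
have kE : k = tperm x (k x) * k' by rewrite /k' mulgA tperm2 mul1g.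
(* Conjugating by [a] moves the transposition to the far left, where it multiplies both [a * k'] and
   [a * k' * a]. *)
pose u := tperm (a^-1 x) (a^-1 (k x)).
have uE : a * tperm x (k x) = u * a.
  by rewrite /u -tpermJ /conjg invgK -!mulgA mulVg mulg1.
have akE : a * k = u * (a * k') by rewrite kE mulgA uE -!mulgA.
have g' : geodesic a k'.
  apply/eqP/eqP; rewrite eqn_leq ncycles_genus Ek' addnS (eqP g) -addnS leq_add2l /=.
  by rewrite akE ncycles_tperm_ge.
have nak : ncycles (a * k') = (ncycles (a * k)).+1.
  by apply/eqP; rewrite -(eqn_add2l #|T|) -(eqP g') Ek' addnS (eqP g) addnS.
have nu : a^-1 x \notin porbit (a * k') (a^-1 (k x)).
  apply/negP => h; have := ncycles_tperm_split h.
  rewrite -/u -akE nak (inj_eq perm_inj) eq_sym kx => /(_ isT); lia.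
have := IH g'; rewrite nak akE -2!mulgA => E.
(* As [a] and [k'] are geodesic, [a] preserves each orbit of [a * k']. The orbits of [a * k' * a]
   thus lie inside those of [a * k'], and [u] joins two cycles here as well. *)
have nu2 : a^-1 x \notin porbit (a * k' * a) (a^-1 (k x)).
  apply: contra nu; set y := a^-1 (k x).
  apply: (@porbit_closed (a * k' * a) (mem (porbit (a * k') y))); last exact: porbit_id.
  move=> z zy; rewrite permM -eq_porbit_mem.
  have -> : porbit (a * k') (a ((a * k') z)) = porbit (a * k') ((a * k') z).
    apply/eqP; rewrite eq_porbit_mem; apply: geodesic_porbit => //.
    by rewrite mem_porbit_step porbit_id.
  by rewrite porbit_step eq_porbit_mem.
have := ncycles_tperm_join nu2; rewrite -/u -!mulgA => E2.
by move: E; rewrite !mulgA in E2 *; rewrite -?mulgA in E2 *; rewrite E2; lia.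
Qed.

End Genus.

(** * Cycles of the square of a permutation *)

Section Square.
Variable T : finType.
Implicit Types (s a : {perm T}) (x y z : T).

Lemma expg_porbit_dvdn s x j : (s ^+ j) x = x -> #|porbit s x| %| j.
Proof.
set N := #|porbit s x| => sj.
have N0 : 0 < N by rewrite lt0n card_porbit_neq0.
have sN : (s ^+ N) x = x by rewrite permX iter_porbit.
have sNq q : (s ^+ (q * N)) x = x.
  by elim: q => [|q IH]; rewrite ?mul0n ?expg0 ?perm1 // mulSn expgD permM sN.
move: sj; rewrite (divn_eq j N) expgD permM sNq permX => sr.
have lr : j %% N < N by rewrite ltn_mod.
have /(nth_uniq x (i := j %% N) (j := 0)) := uniq_traject_porbit s x.
rewrite size_traject -/N => /(_ lr N0).
rewrite nth_traject // nth_traject //= sr eqxx => /esym/eqP ->.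
by rewrite addn0 dvdn_mull.
Qed.

Lemma porbit_square_step s x : (s x \in porbit (s * s) x) = odd #|porbit s x|.
Proof.
have ssE i : (s * s) ^+ i = s ^+ (2 * i)%N by rewrite expgM.
have N0 : 0 < #|porbit s x| by rewrite lt0n card_porbit_neq0.
apply/porbitP/idP => [[i]|oddN].
  rewrite ssE => E.
  (* Let [N] be the size of the orbit. If [s x = s^(2i) x], then [s^(2i + N - 1)] fixes [x], so [N]
     divides an exponent that would be odd for even [N]. *)
  have /expg_porbit_dvdn : (s ^+ (2 * i + #|porbit s x|.-1)) x = x.
    by rewrite expgD permM -E -permM -expgS prednK // permX iter_porbit.
  case/dvdnP => q /(congr1 odd); move: N0; case: #|porbit s x| => // N _.
  by rewrite oddD !oddM /=; case: (odd N); rewrite ?andbF.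
(* For odd [N] the exponent [N + 1] is even and [s^(N + 1) x = s x]. *)
exists (uphalf #|porbit s x|); rewrite ssE.
have -> : (2 * uphalf #|porbit s x| = (#|porbit s x|).+1)%N by lia.
by rewrite expgSr permM [(s ^+ _) x]permX iter_porbit.
Qed.

Lemma porbit_square_sub s x y : y \in porbit (s * s) x -> y \in porbit s x.
Proof.
apply: (@porbit_closed _ _ (mem (porbit s x))); last exact: porbit_id.
by move=> z zx; rewrite permM !mem_porbit_step.
Qed.

Lemma porbit_square_cover s x y : y \in porbit s x ->
  (y \in porbit (s * s) x) || (y \in porbit (s * s) (s x)).
Proof.
have ssE i : (s * s) ^+ i = s ^+ (2 * i)%N by rewrite expgM.
pose A := [pred y | (y \in porbit (s * s) x) || (y \in porbit (s * s) (s x))].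
apply: (@porbit_closed _ s A); rewrite ?inE ?porbit_id //.
move=> z; rewrite !inE => /orP [] /porbitP [i ->]; apply/orP; [right|left]; apply/porbitP.
  exists i; rewrite -!permM ssE; congr (fun_of_perm _ x).
  by rewrite -expgS -expgSr.
exists i.+1; rewrite -!permM !ssE; congr (fun_of_perm _ x).
by rewrite mulnS addSn add1n expgS expgSr mulgA.
Qed.

(** A cycle of odd length remains one cycle of [s * s], one of even length breaks into two; [h]
    sends a cycle of [s * s] to the cycle of [s] around it. *)
Lemma ncycles_square s :
  ncycles (s * s) = ncycles s + #|[set B in porbits s | ~~ odd #|B|]|.
Proof.
pose h (C : {set T}) := \bigcup_(x in C) porbit s x.
have hE x : h (porbit (s * s) x) = porbit s x.
  apply/setP => z; apply/bigcupP/idP => [[y /porbit_square_sub yx zy]|zx].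
    by move: yx zy; rewrite -eq_porbit_mem => /eqP ->.
  by exists x => //; apply: porbit_id.
rewrite {1}/ncycles -sum1_card (partition_big h (mem (porbits s))) /=; last first.
  by move=> C /imsetP [x _ ->]; rewrite hE imset_f.
transitivity (\sum_(B in porbits s) (1 + ~~ odd #|B|)); last first.
  rewrite big_split /= sum1_card -/(ncycles s); congr (_ + _).
  rewrite -sum1_card big_mkcond [RHS]big_mkcond; apply: eq_bigr => B _.
  by rewrite inE; case: (_ \in _) => //=; case: odd.
apply: eq_bigr => B /imsetP [x _ ->]; rewrite sum1dep_card.
rewrite (_ : [set _ | _] = [set porbit (s * s) x; porbit (s * s) (s x)]).
  by rewrite cards2 eq_sym eq_porbit_mem porbit_square_step addnC addn1.
apply/setP => C; rewrite !inE; apply/andP/orP => [[/imsetP [y _ ->]]|].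
  rewrite hE !eq_porbit_mem => /porbit_square_cover/orP []; by [left|right].
case=> /eqP ->; rewrite hE imset_f //; split=> //; by rewrite porbit_step.
Qed.

Lemma ncycles_geodesic_even a k : geodesic a k ->
  ncycles (a * k * a) = ncycles (a * k) + #|[set B in porbits a | ~~ odd #|B|]|.
Proof. move=> g; have := ncycles_geodesic_mul g; rewrite ncycles_square; lia. Qed.

End Square.

(** * Geodesics to the long cycle are increasing and noncrossing *)

Section Cycle.
Variable q : nat.
Notation I := 'I_q.+1.
Implicit Types (s t k : {perm I}) (x y z w : I).

Definition rot1 : {perm I} := perm (@ordS_inj q.+1).

Lemma rot1E x : val (rot1 x) = (x.+1 %% q.+1)%N.
Proof. by rewrite permE. Qed.

Lemma rot1_lt x : x < q -> val (rot1 x) = x.+1.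
Proof. by move=> lx; rewrite rot1E modn_small. Qed.

Lemma rot1_max x : x >= q -> val (rot1 x) = 0%N.
Proof.
move=> lx; rewrite rot1E; have -> : nat_of_ord x = q by have := ltn_ord x; lia.
by rewrite modnn.
Qed.

Lemma ncycles_rot1 : ncycles rot1 = 1%N.
Proof.
have E i : (i <= q)%N -> val ((rot1 ^+ i) ord0) = i.
  elim: i => [|i IH] li; first by rewrite expg0 perm1.
  by rewrite expgSr permM rot1_lt IH //; lia.
have EE x : porbit rot1 x = [set: I].
  have -> : x = (rot1 ^+ x) ord0 by apply: val_inj; rewrite E // -ltnS.
  rewrite porbit_perm; apply/setP => y; rewrite inE; apply/porbitP; exists y.
  by apply: val_inj; rewrite E // -ltnS.
rewrite /ncycles (_ : porbits rot1 = [set [set: I]]) ?cards1 //.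
apply/setP => B; rewrite inE; apply/imsetP/eqP => [[x _ ->]|->]; rewrite ?EE //.
by exists ord0; rewrite ?EE.
Qed.

(** The swap sends [y] to [x + 1], so it cuts off the arc [(x, y]] from the long cycle. All order
    properties of geodesics come from this. *)
Lemma arc_closed x y z w : x < y -> w \in porbit (tperm x y * rot1) z ->
  (x < z <= y)%N = (x < w <= y)%N.
Proof.
move=> lxy.
have cl (u : I) : (x < u <= y)%N -> (x < (tperm x y * rot1)%g u <= y)%N.
  have := ltn_ord y; rewrite permM; case: tpermP => [->|->|]; rewrite ?ltnn //.
    move=> ly _; have lx : x < q by exact: leq_trans lxy _.
    by rewrite rot1_lt // ltnSn lxy.
  move=> /eqP nux /eqP nuy ly /andP [xu uy]; have luy : u < y by rewrite ltn_neqAle uy andbT; exact: nuy.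
  have lq : u < q by exact: leq_trans luy _.
  by rewrite rot1_lt // luy andbT ltnW.
have cl2 (u v : I) : v \in porbit (tperm x y * rot1) u -> (x < u <= y)%N -> (x < v <= y)%N.
  move=> vu u_in; exact: (@porbit_closed _ _ [pred u : I | (x < u <= y)%N] cl u v u_in vu).
by move=> wz; apply/idP/idP; apply: cl2; rewrite // porbit_sym.
Qed.

(* [s x] is the cyclic successor of [x] inside the cycle of [s] through [x]. *)
Definition increasing s := forall x z, z \in porbit s x ->
  if x < s x then ~~ (x < z < s x)%N else (s x <= z <= x)%N.

Lemma porbit_tperm_off s x y z w : x \notin porbit s z -> y \notin porbit s z ->
  w \in porbit s z -> w \in porbit (tperm x y * s) z.
Proof.
move=> xz yz wz; pose A := [pred u | (u \in porbit (tperm x y * s) z) && (u \in porbit s z)].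
suff /andP [] : A w by [].
apply: (@porbit_closed _ s A _ z w _ wz); last by rewrite inE !porbit_id.
move=> u; rewrite !inE mem_porbit_step => /andP [uz1 uz]; rewrite uz andbT.
have -> : s u = (tperm x y * s) u.
  rewrite permM tpermD //; [by apply: contraNneq xz => ->|by apply: contraNneq yz => ->].
by rewrite mem_porbit_step.
Qed.

(** The product detaches [s x] as a fixed point and sends [x] to [s (s x)], so the rest of the cycle
    stays connected. *)
Lemma porbit_tperm_step s x z : z \in porbit s x -> z != s x ->
  z \in porbit (tperm x (s x) * s) x.
Proof.
move=> zx nz; pose t := tperm x (s x) * s.
pose A := [pred u | (u \in porbit t x) || (u == s x)].
suff : A z by rewrite /= (negPf nz) orbF.
apply: (@porbit_closed _ s A _ x z _ zx); last by rewrite inE porbit_id.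
move=> u; rewrite !inE => /orP [ut|/eqP ->].
  have [->|nux] := eqVneq u x; first by rewrite eqxx orbT.
  have [->|nusx] := eqVneq u (s x).
    by have -> : s (s x) = t x by [rewrite permM tpermL]; rewrite mem_porbit_step porbit_id.
  have -> : s u = t u by rewrite permM tpermD // eq_sym.
  by rewrite mem_porbit_step ut.
have -> : s (s x) = t x by rewrite permM tpermL.
by rewrite mem_porbit_step porbit_id.
Qed.

(** Detaching [s x] keeps [z] together with [x] on a geodesic to [tperm x (s x) * rot1], so
    [arc_closed] puts [z] and [x] on the same side of the arc between [x] and [s x]. *)
Lemma geodesic_rot1_increasing s : geodesic s (s^-1 * rot1) -> increasing s.
Proof.
move=> g x z zx.
have [Ex|nx] := eqVneq (s x) x.
  rewrite Ex ltnn; suff -> : z = x by rewrite leqnn.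
  apply/eqP; apply: (@porbit_closed _ s (pred1 x) _ x z _ zx); rewrite ?inE //.
  by move=> u /eqP ->; rewrite Ex inE.
have xsx : x \in porbit s (s x) by rewrite porbit_sym mem_porbit_step porbit_id.
have [] := geodesic_split g xsx; first by rewrite eq_sym.
move=> g' _.
have [Ez|nz] := eqVneq z (s x).
  by rewrite Ez; case: ltnP => // ; rewrite ?ltnn ?andbF ?leqnn //=; lia.
have := geodesic_porbit g' (porbit_tperm_step zx nz).
rewrite -mulgA mulKVg; case: (ltngtP x (s x)) => [lt|lt|/val_inj/esym/eqP]; last by rewrite (negPf nx).
  move=> /(arc_closed lt); rewrite ltnn /= => /esym/negbT; apply: contra => /andP [-> /ltnW]; exact.
rewrite tpermC => /(arc_closed lt); rewrite lt leqnn /= => /esym/andP [/ltnW -> ->].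
by [].
Qed.

Lemma noncrossingP (P : {set {set I}}) :
  reflect (forall (B1 B2 : {set I}) (a b c d : I), B1 \in P -> B2 \in P -> B1 != B2 ->
     (a < b)%N -> (b < c)%N -> (c < d)%N -> a \in B1 -> c \in B1 -> b \in B2 -> d \notin B2)
   (noncrossing P).
Proof.
apply: (iffP forall_inP) => [h B1 B2 a b c d P1 P2 n ab bc cd aB cB bB|h B1 P1].
  move/forall_inP: (h _ P1) => /(_ _ P2); rewrite n => /existsPn /(_ a) /existsPn /(_ b) /existsPn /(_ c) /existsPn /(_ d).
  by rewrite ab bc cd aB cB bB.
apply/forall_inP => B2 P2; apply/implyP => n.
apply/existsPn => a; apply/existsPn => b; apply/existsPn => c; apply/existsPn => d.
by apply/negP => /and5P [ab bc cd aB /and3P [cB bB dB]]; have := h _ _ _ _ _ _ P1 P2 n ab bc cd aB cB bB; rewrite dB.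
Qed.

Lemma porbits_partition s : partition (porbits s) [set: I].
Proof.
apply/and3P; split.
- rewrite eqEsubset subsetT; apply/subsetP => x _; apply/bigcupP.
  by exists (porbit s x); rewrite ?imset_f ?porbit_id.
- apply/trivIsetP => _ _ /imsetP [x _ ->] /imsetP [y _ ->] n.
  rewrite -setI_eq0; apply: contraNT n => /set0Pn [z].
  by rewrite inE -!eq_porbit_mem => /andP [/eqP -> /eqP ->].
apply/negP => /imsetP [x _ /setP /(_ x)]; by rewrite inE porbit_id.
Qed.

Lemma porbits_porbit s B x : B \in porbits s -> x \in B -> B = porbit s x.
Proof. by case/imsetP => y _ ->; rewrite -eq_porbit_mem => /eqP ->. Qed.

(** Splitting [s] at [a] and [c] leaves the block of [b] and [d] intact, yet [b] is in the arc
    [(a, c]] and [d] is not. *)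
Lemma geodesic_rot1_noncrossing s : geodesic s (s^-1 * rot1) -> noncrossing (porbits s).
Proof.
move=> g; apply/noncrossingP => B1 B2 a b c d P1 P2 n ab bc cd aB cB bB; apply/negP => dB.
have E1 := porbits_porbit P1 cB; have E2 := porbits_porbit P2 dB.
have nac : a != c by rewrite -val_eqE /=; lia.
have off u : u \in B1 -> u \notin porbit s d.
  rewrite -E2 => uB; apply: contra n => uB2.
  by rewrite (porbits_porbit P1 uB) (porbits_porbit P2 uB2).
have ac : a \in porbit s c by rewrite -E1.
have [g' _] := geodesic_split g ac nac.
have bd : b \in porbit s d by rewrite -E2.
have := geodesic_porbit g' (porbit_tperm_off (off _ aB) (off _ cB) bd).
rewrite -mulgA mulKVg => /(arc_closed (ltn_trans ab bc)).
by rewrite ab (ltnW bc) /= => /andP [_]; lia.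
Qed.

(** Both [s x] and [t x] lie in the common orbit of [x], so neither can come strictly before the
    other in cyclic order from [x]. *)
Lemma increasing_inj s t : increasing s -> increasing t -> porbits s = porbits t -> s = t.
Proof.
move=> incs inct E; apply/permP => x.
have Ex : porbit s x = porbit t x.
  by apply: porbits_porbit; rewrite -?E ?imset_f ?porbit_id.
have h1 := incs x (t x); have h2 := inct x (s x).
rewrite Ex !mem_porbit_step porbit_id in h1; rewrite -Ex !mem_porbit_step porbit_id in h2.
apply: val_inj => /=; move: {h1 h2} (h1 isT) (h2 isT).
move: (s x) (t x) => a b; case: (ltnP x a); case: (ltnP x b) => ? ? l1 l2; lia.
Qed.

End Cycle.

Lemma leq_card_invariant (T : finType) (U : finType) (s : {perm T}) (f : T -> U) (x0 : T) :
  (forall x, f (s x) = f x) -> #|f @: T| <= ncycles s.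
Proof.
move=> fs.
have fE x y : y \in porbit s x -> f y = f x.
  move=> yx; apply/eqP; apply: (@porbit_closed _ s [pred u | f u == f x] _ x y _ yx).
    by move=> u /eqP h; rewrite inE fs h.
  by rewrite inE.
pose g (B : {set T}) := f (odflt x0 [pick x in B]).
apply: leq_trans (leq_imset_card g (porbits s)); apply: subset_leq_card.
apply/subsetP => _ /imsetP [x _ ->]; apply/imsetP; exists (porbit s x); rewrite ?imset_f //.
rewrite /g; case: pickP => [y /= yx|/(_ x)]; first by rewrite (fE _ _ yx).
by rewrite porbit_id.
Qed.

(** * From noncrossing partitions back to geodesics *)

Section Succ.
Variable q : nat.
Notation I := 'I_q.+1.
Implicit Types (s t k : {perm I}) (x y z w : I).
Variable P : {set {set I}}.
Hypothesis Ppart : partition P [set: I].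

Let Pcover x : x \in cover P. Proof. by rewrite (cover_partition Ppart) inE. Qed.
Let Ptriv : trivIset P. Proof. by case/and3P: Ppart. Qed.

(** [enum] lists a block in increasing order, so [next] is the cyclic successor within it. *)
Definition succ x : I := next (enum (pblock P x)) x.
Definition predc x : I := prev (enum (pblock P x)) x.

Lemma mem_pblockT x : x \in pblock P x. Proof. by rewrite mem_pblock. Qed.

Lemma pblock_eq x y : y \in pblock P x -> pblock P y = pblock P x.
Proof. by move=> yx; apply: same_pblock. Qed.

Lemma succ_in x : succ x \in pblock P x.
Proof. by rewrite -mem_enum mem_next mem_enum mem_pblockT. Qed.

Lemma succK : cancel succ predc.
Proof. by move=> x; rewrite /predc (pblock_eq (succ_in x)) /succ prev_next ?enum_uniq. Qed.

Definition succ_perm : {perm I} := perm (can_inj succK).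

Lemma porbit_succ x : porbit succ_perm x = pblock P x.
Proof.
apply/setP => y; apply/idP/idP => [|yx].
  apply: (@porbit_closed _ _ (mem (pblock P x))); last exact: mem_pblockT.
  by move=> u ux; rewrite permE /= -(pblock_eq ux) succ_in.
have /(fconnect_cycle (cycle_next (enum_uniq (pblock P x)))) E : x \in enum (pblock P x).
  by rewrite mem_enum mem_pblockT.
have : fconnect (next (enum (pblock P x))) x y by rewrite E mem_enum.
move/iter_findex; move: (findex _ _ _) => i <-.
suff -> : iter i (next (enum (pblock P x))) x = (succ_perm ^+ i) x by rewrite mem_porbit.
elim: i => [|i IH]; first by rewrite expg0 perm1.
rewrite /= IH expgSr permM [in RHS]permE /succ.
suff /pblock_eq -> : (succ_perm ^+ i) x \in pblock P x by [].
by rewrite -IH; elim: i {IH} => [|i IH] /=; rewrite ?mem_pblockT // -mem_enum mem_next mem_enum.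
Qed.

Lemma porbits_succ : porbits succ_perm = P.
Proof.
apply/setP => B; apply/imsetP/idP => [[x _ ->]|PB]; first by rewrite porbit_succ pblock_mem.
have /set0Pn [x xB] : B != set0 by apply: contraNneq (_ : set0 \notin P) => [<- //|]; case/and3P: Ppart.
by exists x; rewrite // porbit_succ (def_pblock Ptriv PB xB).
Qed.

Lemma index_enum_lt (B : {set I}) x y : x \in B -> y \in B ->
  (index x (enum B) < index y (enum B)) = (x < y).
Proof.
move=> xB yB; pose r := relpre (@nat_of_ord q.+1) ltn.
have tr : transitive r by move=> u v w; apply: ltn_trans.
have so : sorted r (enum B).
  rewrite /enum_mem; apply: sorted_filter => //.
  by rewrite -sorted_map -enumT val_enum_ord iota_ltn_sorted.
have h u v : u \in B -> v \in B -> index u (enum B) < index v (enum B) -> u < v.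
  move=> uB vB; apply: (sorted_ltn_index tr so); rewrite mem_enum //.
case: (ltngtP (index x (enum B)) (index y (enum B))) => [/h ->//|/h|E].
  by move=> /(_ yB xB) l; apply/esym/negbTE; rewrite -leqNgt ltnW.
have -> : x = y by rewrite -(nth_index x (s := enum B) (x := x)) ?mem_enum // E nth_index ?mem_enum.
by rewrite ltnn.
Qed.

Lemma succ_increasing : increasing succ_perm.
Proof.
move=> x z; rewrite porbit_succ permE => zx.
set B := pblock P x in zx *.
have xB : x \in B := mem_pblockT x.
have sB : succ x \in B := succ_in x.
have E : index (succ x) (enum B) = if (index x (enum B)).+1 < size (enum B) then (index x (enum B)).+1 else 0.
  rewrite /succ next_nth -/B mem_enum xB.
  have := enum_uniq B; have : x \in enum B by rewrite mem_enum.
  case: (enum B) => // y c xc u.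
  case: ltnP => [lt|ge].
    have -> : nth y c (index x (y :: c)) = nth y (y :: c) (index x (y :: c)).+1 by [].
    by rewrite index_uniq.
  by rewrite nth_default // index_head.
have lz : index z (enum B) < size (enum B) by rewrite index_mem mem_enum.
rewrite (leqNgt (succ x)) (leqNgt z x) -!(@index_enum_lt B) // E.
case: (ltnP (index x (enum B)).+1); case: ifP; lia.
Qed.

Hypothesis Pnc : noncrossing P.

Definition nonmin := [set y | [exists z in pblock P y, z < y]].

Lemma card_nonmin : #|nonmin| + #|P| = q.+1.
Proof.
have -> : #|P| = #|~: nonmin|; last by rewrite cardsC card_ord.
have minP y : y \in ~: nonmin -> forall z, z \in pblock P y -> y <= z.
  rewrite !inE => /existsPn h z zy; rewrite leqNgt; apply: contra (h z) => lt.
  by rewrite zy.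
rewrite -(@card_in_imset _ _ (pblock P)) => [|x y /minP hx /minP hy E].
  apply: eq_card => B; apply/idP/imsetP => [PB|[x _ ->]]; last by rewrite pblock_mem.
  have /set0Pn [x xB] : B != set0 by apply: contraNneq (_ : set0 \notin P) => [<- //|]; case/and3P: Ppart.
  have [y yB ymin] := arg_minnP (@nat_of_ord q.+1) xB.
  exists y; rewrite ?(def_pblock Ptriv PB yB) // !inE (def_pblock Ptriv PB yB).
  by apply/existsPn => z; apply/negP => /andP [/ymin]; rewrite leqNgt => /negbTE ->.
apply/eqP; rewrite -val_eqE eqn_leq hx ?hy //; by rewrite (E, esym E) mem_pblockT.
Qed.

(* The arc of [P] closest above the gap [(x, x + 1)] is a label shared by the
   whole orbit of the Kreweras complement through [x]. *)
Definition above x y := (x < y) && [exists z in pblock P y, z <= x].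
Definition label x := [pick y | above x y && [forall v, above x v ==> (y <= v)]].

Lemma label_some x y : above x y -> (forall v, above x v -> y <= v) -> label x = Some y.
Proof.
move=> axy ymin; rewrite /label; case: pickP => [w /andP [axw /forallP wmin]|/(_ y)].
  congr Some; apply/val_inj/eqP; rewrite eqn_leq ymin // andbT.
  by move: (wmin y); rewrite axy.
by rewrite axy /= => /negbT/forallPn [v]; rewrite negb_imply => /andP [/ymin ->].
Qed.

Lemma crossing_eq (a b c d : I) : (a < b)%N -> (b < c)%N -> (c < d)%N ->
  c \in pblock P a -> d \in pblock P b -> pblock P a = pblock P b.
Proof.
move=> ab bc cd ca db; apply/eqP; apply: contraTT db => n.
move/noncrossingP: Pnc; apply; [exact: pblock_mem (Pcover a)|exact: pblock_mem (Pcover b)|exact: n|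
  exact: ab|exact: bc|exact: cd|exact: mem_pblockT|exact: ca|exact: mem_pblockT].
Qed.

(** Here [w] is the image of [x] under [rot1 * succ_perm^-1]. If [w < y], then [y = x + 1] is the
    label of [x], and also that of [w]: an arc ending between [w] and [y] would cross the block or
    belong to it. *)
Lemma label_step w y x : succ_perm w = y -> rot1 q x = y -> label w = label x.
Proof.
move=> sw rx.
have wy : y \in pblock P w by rewrite -sw permE succ_in.
have yw := pblock_eq wy.
have inc v : v \in pblock P w -> if w < y then ~~ (w < v < y)%N else (y <= v <= w)%N.
  by have := @succ_increasing w v; rewrite porbit_succ sw.
have rxv : (x < q /\ y = x.+1 :> nat) \/ (x = q :> nat /\ y = 0%N :> nat).
  case: (ltnP x q) => lx; [left|right]; rewrite -rx.
    by split=> //; exact: rot1_lt.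
  by split; [apply/eqP; rewrite eqn_leq lx -ltnS ltn_ord|exact: rot1_max].
case: (ltnP w y) inc => [lwy inc|lyw inc].
  have yE : nat_of_ord y = x.+1 by case: rxv => [[_ //]|[_ y0]]; move: lwy; rewrite y0.
  have ax : above x y.
    rewrite /above yE ltnSn; apply/existsP; exists w; rewrite yw mem_pblockT -ltnS -yE; exact: lwy.
  have aw : above w y.
    by rewrite /above lwy; apply/existsP; exists w; rewrite yw mem_pblockT leqnn.
  rewrite (label_some ax); last by move=> v /andP []; rewrite yE.
  apply: (label_some aw) => v /andP [wv /existsP [z /andP [zv zw]]].
  rewrite leqNgt; apply/negP => vy.
  have vz : v \in pblock P z by rewrite (pblock_eq zv) mem_pblockT.
  have [Ezw|nzw] := eqVneq z w.
    by have := inc v; rewrite -Ezw vz Ezw wv vy => /(_ isT).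
  have zlw : z < w by rewrite ltn_neqAle zw andbT.
  have E := crossing_eq zlw wv vy vz wy.
  by have := inc v; rewrite -E vz wv vy => /(_ isT).
(* Now [w] is the largest and [y] the smallest point of the block. By noncrossing, an arc over the
   gap after [w] encloses the whole block, hence passes over the gap before [y], and conversely. *)
rewrite /label; suff E v : above w v = above x v.
  by apply: eq_pick => v; rewrite /= E; congr (_ && _); apply: eq_forallb => u; rewrite E.
have vS z : z \in pblock P v -> v \in pblock P z by move=> zv; rewrite (pblock_eq zv) mem_pblockT.
have wyb : w \in pblock P y by rewrite yw mem_pblockT.
have out (u u1 : I) : u \in pblock P w -> u1 \in pblock P u -> (y <= u1 <= w)%N.
  by move=> uw u1u; apply: inc; rewrite -(pblock_eq uw).
rewrite /above; apply/andP/andP => -[lv /existsP [z /andP [zv zl]]].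
  have nz : z < y.
    rewrite ltnNge; apply/negP => yz.
    have zw : z \notin pblock P w.
      by apply/negP => /out /(_ (vS _ zv)) /andP [_]; rewrite leqNgt lv.
    have yz1 : y < z.
      by rewrite ltn_neqAle yz andbT; apply: contraNneq zw => /val_inj <-.
    have zw1 : z < w.
      by rewrite ltn_neqAle zl andbT; apply: contraNneq zw => /val_inj ->; apply: mem_pblockT.
    have := crossing_eq yz1 zw1 lv wyb (vS _ zv).
    by move=> E; move: zw; rewrite -yw E mem_pblockT.
  case: rxv => [[_ yE]|[_ y0]]; last by rewrite y0 in nz.
  rewrite yE in nz lyw; split; first by apply: leq_trans lyw (ltnW lv).
  by apply/existsP; exists z; rewrite zv.
have yE : nat_of_ord y = x.+1.
  by case: rxv => [[_ ->] //|[xE _]]; move: lv (ltn_ord v); rewrite xE ltnS; case: ltngtP.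
have zy : z < y by rewrite yE.
have zw : z \notin pblock P w.
  by apply/negP => /inc; rewrite leqNgt zy.
have vw : v \notin pblock P w.
  by apply: contra zw => /pblock_eq <-.
have yv : y < v.
  rewrite ltn_neqAle yE lv andbT -yE; apply: contraNneq vw => /val_inj <-; exact: wy.
have wv : w < v.
  rewrite ltnNge leq_eqVlt; apply/negP => /orP [/eqP/val_inj E|vltw].
    by move: vw; rewrite E mem_pblockT.
  have E := crossing_eq zy yv vltw (vS _ zv) wyb.
  by move: zw; rewrite -yw -E mem_pblockT.
split=> //; apply/existsP; exists z; rewrite zv /=; apply: leq_trans lyw; exact: ltnW.
Qed.

(** One inequality is [ncycles_genus]. For the other, the complement has at least as many cycles as
    there are labels: [None] and the [q + 1 - #|P|] points that are not minimal in their block. *)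
Lemma geodesic_succ : geodesic succ_perm (succ_perm^-1 * rot1 q).
Proof.
have n1 : ncycles succ_perm = #|P| by rewrite /ncycles porbits_succ.
apply/eqP/eqP; rewrite eqn_leq ncycles_genus /= mulKVg ncycles_rot1 n1 card_ord ncyclesC.
have inv x : label ((rot1 q * succ_perm^-1) x) = label x.
  by apply: label_step; rewrite // permM permKV.
apply: leq_trans (leq_add (leqnn _) (leq_card_invariant ord0 inv)).
suff sub : None |: [set Some y | y in nonmin] \subset label @: I.
  apply: leq_trans (leq_add (leqnn _) (subset_leq_card sub)).
  rewrite cardsU1 card_imset; last by move=> ? ? [].
  have -> : None \notin [set Some y | y in nonmin] by apply/negP => /imsetP [].
  by rewrite addnCA [(#|P| + _)%N]addnC card_nonmin addn1.
apply/subsetP => _ /setU1P [->|/imsetP [y ynm ->]]; apply/imsetP.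
  (* No arc passes over the last gap, whose label is therefore [None]; a non-minimal [y] is the
     label of [y - 1]. *)
  exists ord_max => //; rewrite /label; case: pickP => // v /andP [/andP [/= lt _] _].
  by move: (ltn_ord v); rewrite ltnS leqNgt lt.
have y0 : 0 < y by move: ynm; rewrite inE => /existsP [z /andP [_]]; apply: leq_trans.
have lp : y.-1 < q.+1 by apply: leq_ltn_trans (leq_pred y) (ltn_ord y).
exists (Ordinal lp) => //; apply/esym/label_some => [|v /andP [/= h _]]; last by rewrite -(prednK y0).
rewrite /above /= prednK // leqnn /=; move: ynm; rewrite inE => /existsP [z /andP [zy lz]].
by apply/existsP; exists z; rewrite zy -ltnS prednK.
Qed.

End Succ.

Lemma Nat_powE a k : Nat.pow a k = (a ^ k)%N.
Proof. by elim: k => //= k ->; rewrite expnS. Qed.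

(** [porbits] is injective on geodesics, which are increasing, and reaches every noncrossing
    partition through [succ_perm]. The predecessor removes the single cycle of [rot1] from
    [1 + e]. *)
Lemma nc_moment_geodesic n m q :
  nc_moment n m q.+1 = (\sum_(s : {perm 'I_q.+1} | geodesic s (s^-1 * rot1 q))
     m ^ ncycles s * n ^ (ncycles (rot1 q * s)).-1)%N.
Proof.
pose A := [set s : {perm 'I_q.+1} | geodesic s (s^-1 * rot1 q)].
transitivity (\sum_(P in [set porbits s | s in A]) m ^ #|P| * n ^ even_blocks P)%N.
  apply: eq_big => P; last by rewrite !Nat_powE.
  apply/andP/imsetP => [[pP nP]|[s sA ->]].
    by exists (succ_perm pP); rewrite ?porbits_succ // inE geodesic_succ.
  by rewrite inE in sA; split; [apply: porbits_partition|apply: geodesic_rot1_noncrossing].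
rewrite big_imset => [|s t] /=; last first.
  rewrite !inE => /geodesic_rot1_increasing si /geodesic_rot1_increasing ti.
  exact: increasing_inj.
apply: eq_big => [s|s]; first by rewrite inE.
rewrite inE => g; congr (_ * n ^ _)%N.
by have := ncycles_geodesic_even g; rewrite mulKVg ncycles_rot1 => ->.
Qed.

End GeodesicPermutations.

From Stdlib Require Import Reals.
From mathcomp Require Import all_boot all_order all_algebra.
From mathcomp Require Import Rstruct complex.
From mathcomp Require Import zify ring.
From Stdlib Require Import FunctionalExtensionality.

Import GRing.Theory Num.Theory GaussianLine GeodesicPermutations.
Local Open Scope complex_scope.
Local Open Scope ring_scope.

(** * The Wick formula *)

Section Contraction.
Variable C : comNzRingType.
Implicit Types (T : eqType).

(** One step of the Wick recursion, summed over the positions of [w]. Deleting by position needs no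
    equality on letters and keeps the linearity proofs structural. *)
Fixpoint contract (T : Type) (c : T -> C) (F : seq T -> C) (w : seq T) : C :=
  if w is a :: w' then c a * F w' + contract c (fun s => F (a :: s)) w' else 0.

Definition perm_invariant T (F : seq T -> C) := forall s t, perm_eq s t -> F s = F t.

(** [rem] deletes the first copy of a letter and not the chosen one; invariance of [F] absorbs the
    difference. *)
Lemma contract_sum T (c : T -> C) (F : seq T -> C) w : perm_invariant F ->
  contract c F w = \sum_(a <- w) c a * F (rem a w).
Proof.
elim: w F => [|a w IH] F Fp /=; first by rewrite big_nil.
rewrite big_cons /= eqxx IH; last by move=> s t st; apply: Fp; rewrite perm_cons.
congr (_ + _); apply: eq_big_seq => b bw; congr (_ * _).
case: eqP => // -> ; apply: Fp; first by rewrite perm_sym perm_to_rem.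
Qed.

Lemma contract_linear (T : Type) (c : T -> C) x y (F G : seq T -> C) w :
  contract c (fun s => x * F s + y * G s) w = x * contract c F w + y * contract c G w.
Proof. by elim: w F G => [|a w IH] F G /=; rewrite ?IH; ring. Qed.

Lemma eq_contract (T : Type) (c c' : T -> C) (F G : seq T -> C) w :
  c =1 c' -> F =1 G -> contract c F w = contract c' G w.
Proof.
move=> cE; elim: w F G => [|a w IH] F G FG //=.
by rewrite cE FG (IH _ (fun s => G (a :: s))) // => s; rewrite FG.
Qed.

Lemma contract_linear_weight (T : Type) x y (c c' : T -> C) (F : seq T -> C) w :
  contract (fun a => x * c a + y * c' a) F w = x * contract c F w + y * contract c' F w.
Proof. by elim: w F => [|a w IH] F /=; rewrite ?IH; ring. Qed.

(* A letter [f] stands for the linear form [al f * x_(v f) + be f * x_(v' f)];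
   [expand F] extends [F] multilinearly from words in the variables to words in letters. *)
Variables (L V : Type) (al be : L -> C) (v v' : L -> V).

Fixpoint expand (F : seq V -> C) (l : seq L) : C :=
  if l is f :: l' then al f * expand (fun s => F (v f :: s)) l' + be f * expand (fun s => F (v' f :: s)) l'
  else F [::].

Lemma expand_linear x y F G l :
  expand (fun s => x * F s + y * G s) l = x * expand F l + y * expand G l.
Proof. by elim: l F G => [|f l IH] F G //=; rewrite !IH; ring. Qed.

Lemma eq_expand F G l : F =1 G -> expand F l = expand G l.
Proof.
elim: l F G => [|f l IH] F G FG //=.
by congr (_ * _ + _ * _); apply: IH => s; rewrite FG.
Qed.

(** Transfers integration by parts from real variables to complex letters. *)
Lemma expand_contract (d : V -> C) F l :
  expand (contract d F) l = contract (fun f => al f * d (v f) + be f * d (v' f)) (expand F) l.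
Proof.
elim: l F => [|f l IH] F //=.
rewrite (contract_linear _ (al f) (be f)).
rewrite -!IH.
have E a : expand (fun s => d a * F s + contract d (fun s => F (a :: s)) s) l =
    d a * expand F l + 1 * expand (contract d (fun s => F (a :: s))) l.
  by rewrite -expand_linear; apply: eq_expand => s; rewrite mul1r.
by rewrite !E; ring.
Qed.

End Contraction.

(** * Expectations of Gaussian polynomials *)

Section GaussPoly.
Local Notation C := (R[i]).
Implicit Types (w : seq nat) (env x : nat -> R).

(** Expectation of a monomial under [gauss_expect K]. Variables of index at least [K] keep the value
    0 of the initial environment, whence the last factor. *)
Definition word_moment (K : nat) w :=
  (\prod_(v < K) gauss_moment (count_mem (v : nat) w)) * (\prod_(v <- w | (K <= v)%N) 0).

(** The environment is arbitrary so that variables not yet integrated remain as parameters in the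
    induction. *)
Lemma gauss_iter_words (P : seq (R * seq nat)) K env :
  gauss_iter K (fun x => \sum_(q <- P) q.1 * \prod_(v <- q.2) x v) env =
  \sum_(q <- P) q.1 * ((\prod_(v < K) gauss_moment (count_mem (v : nat) q.2)) * (\prod_(v <- q.2 | (K <= v)%N) env v)).
Proof.
elim: K env => [|K IH] env /=.
  by apply: eq_bigr => q _; rewrite big_ord0 mul1r.
apply: Rint_line_eq.
pose a (q : R * seq nat) := q.1 * ((\prod_(v < K) gauss_moment (count_mem (v : nat) q.2)) * (\prod_(v <- q.2 | (K < v)%N) env v)).
have -> : (fun t => gauss t * gauss_iter K (fun x => \sum_(q <- P) q.1 * \prod_(v <- q.2) x v) (upd env K t)) =
  (fun t => \sum_(q <- P) a q * (gauss t * t ^+ count_mem K q.2)).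
  apply: functional_extensionality => t; rewrite IH big_distrr; apply: eq_bigr => q _ /=.
  have -> : \prod_(v <- q.2 | (K <= v)%N) upd env K t v = t ^+ count_mem K q.2 * \prod_(v <- q.2 | (K < v)%N) env v.
    elim: q.2 => [|v w IHw]; first by rewrite !big_nil mul1r.
    rewrite !big_cons /= IHw /upd; case: (ltngtP K v) => [lt|lt|->].
    - have -> : Nat.eqb v K = false by apply/PeanoNat.Nat.eqb_neq; lia.
      by rewrite add0n; ring.
    - by rewrite add0n.
    by rewrite PeanoNat.Nat.eqb_refl add1n exprS mulrA.
  rewrite /a; ring.
have -> : \sum_(q <- P) q.1 * ((\prod_(v < K.+1) gauss_moment (count_mem (v : nat) q.2)) * (\prod_(v <- q.2 | (K < v)%N) env v)) =
  \sum_(q <- P) a q * gauss_moment (count_mem K q.2).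
  by apply: eq_bigr => q _; rewrite big_ord_recr /= /a; ring.
elim: P {IH} => [|q P IHP].
  rewrite big_nil; apply: line_integral_ext line_integral_0 => t; by rewrite big_nil.
rewrite big_cons; apply: line_integral_ext (line_integral_plus _ _ _ _ (line_integral_scal (a q) _ _ (line_integral_gauss_moment (count_mem K q.2))) IHP) => t.
by rewrite big_cons; congr (_ + _); rewrite RmultE RpowE.
Qed.

Lemma word_moment_perm K s t : perm_eq s t -> word_moment K s = word_moment K t.
Proof.
move=> st; rewrite /word_moment (perm_big _ st); congr (_ * _).
by apply: eq_bigr => v _; rewrite (seq.permP st).
Qed.

Lemma gauss_momentSS k : gauss_moment k.+2 = k.+1%:R * gauss_moment k.
Proof. by rewrite -INRE. Qed.

(* Gaussian integration by parts *)
Lemma word_moment_cons K v w : (v < K)%N ->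
  word_moment K (v :: w) = (count_mem v w)%:R * word_moment K (rem v w).
Proof.
move=> vK; rewrite /word_moment big_cons leqNgt vK /=.
rewrite (bigD1 (Ordinal vK)) //= eqxx add1n.
case: (boolP (v \in w)) => vw; last first.
  by rewrite (count_memPn vw) [gauss_moment _]R0E !mul0r.
have pw := perm_to_rem vw.
rewrite (seq.permP pw) [count _ (v :: _)]/= eqxx add1n gauss_momentSS (perm_big _ pw) big_cons leqNgt vK /=.
rewrite [in RHS](bigD1 (Ordinal vK)) //= !mulrA; congr (_ * _ * _).
apply: eq_bigr => u nu; rewrite (seq.permP pw) /=.
by have -> : (v == u) = false by apply: contraNF nu => /eqP E; apply/eqP/val_inj.
Qed.

Definition has_moment K (f : (nat -> R) -> C) (e : C) :=
  exists P : seq (C * seq nat),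
    (forall x, f x = \sum_(q <- P) q.1 * \prod_(v <- q.2) (x v)%:C) /\
    e = \sum_(q <- P) q.1 * (word_moment K q.2)%:C.

Lemma re_real (z : C) (r : R) : complex.Re (z * r%:C) = complex.Re z * r.
Proof. by case: z => a b /=; rewrite mulr0 subr0. Qed.

Lemma im_real (z : C) (r : R) : complex.Im (z * r%:C) = complex.Im z * r.
Proof. by case: z => a b /=; rewrite mulr0 add0r. Qed.

Lemma re_sum (J : Type) (r : seq J) (F : J -> C) :
  complex.Re (\sum_(j <- r) F j) = \sum_(j <- r) complex.Re (F j).
Proof.
elim: r => [|j r IH]; first by rewrite !big_nil.
by rewrite !big_cons -IH; case: (F j) (\sum_(_ <- _) _) => [? ?] [? ?].
Qed.

Lemma im_sum (J : Type) (r : seq J) (F : J -> C) :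
  complex.Im (\sum_(j <- r) F j) = \sum_(j <- r) complex.Im (F j).
Proof.
elim: r => [|j r IH]; first by rewrite !big_nil.
by rewrite !big_cons -IH; case: (F j) (\sum_(_ <- _) _) => [? ?] [? ?].
Qed.

Lemma has_moment_expect K f e : has_moment K f e ->
  gauss_expect K (fun x => complex.Re (f x)) = complex.Re e /\ gauss_expect K (fun x => complex.Im (f x)) = complex.Im e.
Proof.
case=> P [fE ->].
have prodE x w : \prod_(v <- w) (x v)%:C = (\prod_(v <- w) x v)%:C :> C by rewrite rmorph_prod.
split.
  have -> : (fun x => complex.Re (f x)) = (fun x => \sum_(q <- [seq (complex.Re q.1, q.2) | q <- P]) q.1 * \prod_(v <- q.2) x v).
    apply: functional_extensionality => x; rewrite fE re_sum big_map; apply: eq_bigr => q _.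
    by rewrite prodE re_real.
  by rewrite /gauss_expect gauss_iter_words big_map re_sum; apply: eq_bigr => q _; rewrite re_real.
have -> : (fun x => complex.Im (f x)) = (fun x => \sum_(q <- [seq (complex.Im q.1, q.2) | q <- P]) q.1 * \prod_(v <- q.2) x v).
  apply: functional_extensionality => x; rewrite fE im_sum big_map; apply: eq_bigr => q _.
  by rewrite prodE im_real.
by rewrite /gauss_expect gauss_iter_words big_map im_sum; apply: eq_bigr => q _; rewrite im_real.
Qed.

(** Both values are the iterated integral of [f], whatever polynomial expression was used. *)
Lemma has_moment_unique K f e e' : has_moment K f e -> has_moment K f e' -> e = e'.
Proof.
move=> /has_moment_expect [a b] /has_moment_expect [a' b'].
by case: e e' a b a' b' => [? ?] [? ?] /= <- <- <- <-.
Qed.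

Lemma has_moment_ext K f g e : f =1 g -> has_moment K f e -> has_moment K g e.
Proof. by move=> fg [P [fE eE]]; exists P; split=> // x; rewrite -fg. Qed.

Lemma has_moment_0 K : has_moment K (fun _ => 0) 0.
Proof. by exists [::]; split=> [x|]; rewrite big_nil. Qed.

Lemma has_moment_add K f g e e' : has_moment K f e -> has_moment K g e' ->
  has_moment K (fun x => f x + g x) (e + e').
Proof.
by move=> [P [fE ->]] [Q [gE ->]]; exists (P ++ Q); split=> [x|]; rewrite big_cat /= ?fE ?gE.
Qed.

Lemma has_moment_scale K c f e : has_moment K f e -> has_moment K (fun x => c * f x) (c * e).
Proof.
move=> [P [fE ->]]; exists [seq (c * q.1, q.2) | q <- P]; split=> [x|]; rewrite big_map ?fE big_distrr /=;
by apply: eq_bigr => q _; rewrite mulrA.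
Qed.

Lemma has_moment_sum K (J : Type) (r : seq J) (f : J -> (nat -> R) -> C) e :
  (forall j, has_moment K (f j) (e j)) ->
  has_moment K (fun x => \sum_(j <- r) f j x) (\sum_(j <- r) e j).
Proof.
move=> h; elim: r => [|j r IH].
  by rewrite big_nil; apply: has_moment_ext (has_moment_0 K) => x; rewrite big_nil.
by rewrite big_cons; apply: has_moment_ext (has_moment_add (h j) IH) => x; rewrite big_cons.
Qed.

End GaussPoly.

(** * Row expansion of permanents *)

Section Permanent.
Variable C : comNzRingType.

Definition permanent p (A : 'I_p -> 'I_p -> C) := \sum_(s : {perm 'I_p}) \prod_k A k (s k).

Lemma permanent_expand p (A : 'I_p.+1 -> 'I_p.+1 -> C) :
  permanent A = \sum_j A ord0 j * permanent (fun k l => A (lift ord0 k) (lift j l)).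
Proof.
rewrite /permanent (partition_big (fun s : {perm 'I_p.+1} => s ord0) predT) //=.
apply: eq_bigr => j _; rewrite big_distrr /=.
rewrite (reindex (lift_perm ord0 j)).
  apply: eq_big => [s|s _]; first by rewrite lift_perm_id eqxx.
  rewrite big_ord_recl lift_perm_id; congr (_ * _).
  by apply: eq_bigr => k _; rewrite lift_perm_lift.
(* Deletes [i] and its image from [s] and renumbers the rest, which inverts [lift_perm]. *)
pose low i (s : {perm 'I_p.+1}) k := odflt k (unlift (s i) (s (lift i k))).
have lowE i (s : {perm 'I_p.+1}) k : lift (s i) (low i s k) = s (lift i k).
  have: s i != s (lift i k) by rewrite (inj_eq perm_inj) neq_lift.
  by rewrite /low => /unlift_some [l -> ->].
have low_inj i (s : {perm 'I_p.+1}) : injective (low i s).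
  by move=> k l /(congr1 (lift (s i))); rewrite !lowE => /perm_inj /lift_inj.
exists (fun s => perm (low_inj ord0 s)) => [s _|s].
  apply/perm.permP => k; rewrite permE; apply: (@lift_inj _ j).
  by have := lowE ord0 (lift_perm ord0 j s) k; rewrite lift_perm_id lift_perm_lift.
rewrite inE => /eqP sj; apply/perm.permP => k.
case: (unliftP ord0 k) => [l ->|->]; last by rewrite lift_perm_id sj.
by rewrite lift_perm_lift permE -sj lowE.
Qed.

End Permanent.

(** * Pairings of complex Gaussians *)

Section Wick.
Local Notation C := (R[i]).
Local Notation L := (bool * nat)%type.
Implicit Types (f g : L) (l : seq L) (x : nat -> R).

(* The letter [(false, u)] is the complex Gaussian built from the real
   variables [2 u] and [2 u + 1]; [(true, u)] is its conjugate. *)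
Definition inv_sqrt2 := @GRing.inv R (@Num.sqrt R 2%:R).

Definition letter x f : C :=
  let z := Complex (@GRing.mul R (x (2 * f.2)%N) inv_sqrt2) (@GRing.mul R (x (2 * f.2).+1) inv_sqrt2) in
  if f.1 then z^* else z.

Definition re_coef f : C := inv_sqrt2%:C.
Definition im_coef f : C := Complex (@GRing.zero R) (if f.1 then @GRing.opp R inv_sqrt2 else inv_sqrt2).
Definition re_var f := (2 * f.2)%N.
Definition im_var f := (2 * f.2).+1.

Lemma letterE x f :
  letter x f = re_coef f * (x (re_var f))%:C + im_coef f * (x (im_var f))%:C.
Proof.
rewrite /letter /re_coef /im_coef /re_var /im_var.
by case: f => [[] u] /=; apply/eqP; rewrite eq_complex /=; apply/andP; split; apply/eqP; ring.
Qed.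

Definition wick K l := expand re_coef im_coef re_var im_var (fun w => (word_moment K w)%:C) l.

Lemma has_moment_letters K l : has_moment K (fun x => \prod_(f <- l) letter x f) (wick K l).
Proof.
suff H w : has_moment K (fun x => \prod_(v <- w) (x v)%:C * \prod_(f <- l) letter x f)
    (expand re_coef im_coef re_var im_var (fun s => (word_moment K (w ++ s))%:C) l).
  by apply: has_moment_ext (H [::]) => x; rewrite big_nil mul1r.
elim: l w => [|f l IH] w /=.
  exists [:: (1, w)]; split=> [x|]; rewrite big_seq1 /= ?big_nil ?mulr1 ?mul1r //.
  by rewrite cats0.
have E a (x : nat -> R) : \prod_(v <- rcons w a) (x v)%:C = \prod_(v <- w) (x v)%:C * (x a)%:C :> C.
  by rewrite -cats1 big_cat big_seq1.
have := has_moment_add (has_moment_scale (re_coef f) (IH (rcons w (re_var f))))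
   (has_moment_scale (im_coef f) (IH (rcons w (im_var f)))).
set e := (X in has_moment _ _ X); set e' := (X in _ -> has_moment _ _ X).
have -> : e = e'.
  by rewrite /e /e'; congr (_ * _ + _ * _); apply: eq_expand => s; rewrite cat_rcons.
apply: has_moment_ext => x; rewrite big_cons letterE !E; ring.
Qed.

(** The expansion is ordered, but the product of the letters is not: symmetry follows from
    uniqueness of the expectation. *)
Lemma wick_perm K : perm_invariant (wick K).
Proof.
move=> s t st; apply: (has_moment_unique (has_moment_letters K s)).
by apply: has_moment_ext (has_moment_letters K t) => x; rewrite (perm_big _ st).
Qed.

Definition covariance f g : C := ((f.2 == g.2) && (f.1 != g.1))%:R.

Lemma word_moment_contract K v w : (v < K)%N ->
  (word_moment K (v :: w))%:C = contract (fun a => (v == a)%:R) (fun s => (word_moment K s)%:C) w :> C.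
Proof.
move=> vK; rewrite word_moment_cons // contract_sum; last first.
  by move=> s t st; rewrite (word_moment_perm _ st).
rewrite rmorphM rmorph_nat -sum1_count natr_sum big_distrl /= [RHS](bigID (fun a => a == v)) /=.
rewrite [X in _ = _ + X]big1 ?addr0; last by move=> a; rewrite eq_sym => /negbTE ->; rewrite mul0r.
by apply: eq_bigr => a /eqP ->; rewrite eqxx.
Qed.

(** Real and imaginary parts contribute [1/2] each: they add up for a letter and its conjugate and
    cancel for two equal letters. *)
Lemma covarianceE f g : covariance f g =
  re_coef f * (re_coef g * (re_var f == re_var g)%:R + im_coef g * (re_var f == im_var g)%:R) +
  im_coef f * (re_coef g * (im_var f == re_var g)%:R + im_coef g * (im_var f == im_var g)%:R).
Proof.
case: f g => [b u] [c t]; rewrite /covariance /re_var /im_var /re_coef /im_coef /=.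
have -> : (2 * u == 2 * t)%N = (u == t) by lia.
have -> : (2 * u == (2 * t).+1)%N = false by lia.
have -> : ((2 * u).+1 == (2 * t))%N = false by lia.
have -> : ((2 * u).+1 == (2 * t).+1)%N = (u == t) by lia.
rewrite !mulr0 addr0 add0r; case: (u == t); last by rewrite !mulr0 addr0.
have s2 : inv_sqrt2 * inv_sqrt2 = (2%:R)^-1.
  by rewrite -invfM -expr2 sqr_sqrtr.
have h : (2%:R)^-1 + (2%:R)^-1 = 1%:R :> Num.NumDomain.sort R by field.
rewrite !mulr1; case: b; case: c => /=; apply/eqP; rewrite eq_complex /=;
 rewrite ?mulrN ?mulNr ?s2 ?mulr0 ?mul0r ?opprK ?addr0 ?subr0 ?subrr ?oppr0 ?addr0 ?h ?add0r ?subrr ?h ?eqxx //.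
Qed.

(** The bound concerns the larger of the two real variables of [f], so that integration by parts
    applies to both. *)
Lemma wick_cons K f l : ((2 * f.2).+1 < K)%N ->
  wick K (f :: l) = \sum_(g <- l) covariance f g * wick K (rem g l).
Proof.
move=> fK; rewrite -(contract_sum (covariance f) _ (@wick_perm K)) /wick /=.
have fK' : (re_var f < K)%N by apply: ltnW.
rewrite (eq_expand _ _ _ _ _ (fun w => word_moment_contract w fK')).
rewrite (eq_expand _ _ _ _ _ (fun w => word_moment_contract w fK)).
rewrite !expand_contract -contract_linear_weight; apply: eq_contract => // g.
by rewrite covarianceE.
Qed.

(** The first plain letter pairs only with conjugates; removing it with its partner is one step of
    [permanent_expand]. *)
Lemma wick_permanent K p (u v : 'I_p -> nat) :
  (forall k, (2 * u k).+1 < K)%N -> (forall k, (2 * v k).+1 < K)%N ->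
  wick K ([seq (false, u k) | k <- enum 'I_p] ++ [seq (true, v k) | k <- enum 'I_p]) =
  permanent (fun k j => (u k == v j)%:R).
Proof.
elim: p u v => [|p IH] u v uK vK.
  rewrite /permanent (eq_bigl (pred1 1%g)); last first.
    by move=> s; rewrite !inE; apply/esym/eqP/perm.permP => -[].
  rewrite big_pred1_eq big_ord0 /wick; have -> : enum 'I_0 = [::] by apply: size0nil; rewrite size_enum_ord.
  by rewrite /= /word_moment big_nil big1 ?mulr1 // => ? _.
rewrite permanent_expand enum_ordSl /= wick_cons //=.
rewrite big_cat /= big_map big1_seq ?add0r; last first.
  by move=> k _; rewrite /covariance /= andbF mul0r.
rewrite -[_ :: _]/(map _ (_ :: _)) -enum_ordSl big_map big_enum /=; apply: eq_bigr => j _.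
rewrite /covariance /= andbT; congr (_ * _).
rewrite -(IH (fun k => u (lift ord0 k)) (fun k => v (lift j k))) //.
apply: wick_perm; rewrite -(perm_cons (true, v j)).
apply: (@perm_trans _ ([seq (false, u (lift ord0 k)) | k <- enum 'I_p] ++ [seq (true, v k) | k <- enum 'I_p.+1])).
  rewrite -map_comp; rewrite perm_sym; apply: perm_to_rem; rewrite mem_cat; apply/orP; right.
  by apply/mapP; exists j; rewrite ?mem_enum.
have Ej : perm_eq (enum 'I_p.+1) (j :: map (lift j) (enum 'I_p)).
  apply: uniq_perm; first exact: enum_uniq.
    rewrite /= (map_inj_uniq (@lift_inj _ j)) enum_uniq andbT.
    by apply/mapP => -[k _ /eqP]; rewrite (negbTE (neq_lift _ _)).
  move=> k; rewrite mem_enum !inE; case: (unliftP j k) => [i ->|->]; rewrite ?eqxx //.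
  by rewrite map_f ?orbT ?mem_enum.
have := perm_map (fun k => (true, v k)) Ej; rewrite /= -map_comp => /(perm_cat (perm_refl _)) Ep.
by apply: perm_trans (Ep _) _; rewrite -(cat1s (true, v j)) -(cat1s _ (_ ++ _)) perm_catCA.
Qed.

End Wick.

(** * Expected traces as sums over permutations *)

Section Counting.
Variable C : comNzRingType.

(** An invariant function amounts to a free value on each cycle, through the injection
    [lift_fun]. *)
Lemma card_porbits_invariant (T X : finType) (s : {perm T}) :
  #|[set g : {ffun T -> X} | [forall k, g k == g (s k)]]| = (#|X| ^ ncycles s)%N.
Proof.
pose B := {A : {set T} | A \in porbits s}.
have mB x : porbit s x \in porbits s by exact: imset_f.
pose lift_fun (h : {ffun B -> X}) : {ffun T -> X} := [ffun x => h (Sub (porbit s x) (mB x))].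
have lift_inj : injective lift_fun.
  move=> h h' /ffunP E; apply/ffunP => -[A AB]; have /imsetP [x _ AE] := AB.
  have := E x; rewrite !ffunE; have -> // : Sub (porbit s x) (mB x) = Sub A AB :> B.
  by apply: val_inj.
have -> : [set g : {ffun T -> X} | [forall k, g k == g (s k)]] = lift_fun @: setT.
  apply/setP => g; rewrite inE; apply/forallP/imsetP => [inv|[h _ ->] k]; last first.
    rewrite !ffunE; apply/eqP; congr (h _); apply: val_inj; by rewrite /= porbit_step.
  have const x y : y \in porbit s x -> g y = g x.
    move=> yx; apply/eqP; apply: (@porbit_closed _ s [pred u | g u == g x] _ x y _ yx); rewrite ?inE //.
    by move=> u; rewrite !inE => /eqP <-; rewrite eq_sym; apply: inv.
  have pickB (b : B) : exists x, x \in val b.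
    by case: b => A /= /imsetP [x _ ->]; exists x; apply: porbit_id.
  exists [ffun b => g (xchoose (pickB b))] => //; apply/ffunP => x; rewrite !ffunE.
  apply/esym/const; exact: (xchooseP (pickB (Sub (porbit s x) (mB x)))).
by rewrite card_imset // cardsT card_ffun card_sig.
Qed.

Lemma sum_porbits_invariant (T X : finType) (s : {perm T}) :
  \sum_(g : {ffun T -> X}) \prod_k (g k == g (s k))%:R = (#|X| ^ ncycles s)%:R :> C.
Proof.
rewrite -card_porbits_invariant -sum1_card natr_sum [RHS]big_mkcond /=.
apply: eq_bigr => g _; rewrite inE; case: (boolP [forall k, _]) => [/forallP inv|].
  by rewrite big1 // => k _; rewrite inv.
by case/forallPn => k nk; rewrite (bigD1 k) //= (negbTE nk) mul0r.
Qed.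

Lemma sum_ffun_pair (T X Y : finType) (F : {ffun T -> X * Y} -> C) :
  \sum_f F f = \sum_(g : {ffun T -> X}) \sum_(h : {ffun T -> Y}) F [ffun k => (g k, h k)].
Proof.
rewrite pair_big /= (reindex (fun gh : {ffun T -> X} * {ffun T -> Y} => [ffun k => (gh.1 k, gh.2 k)])) //.
exists (fun f : {ffun T -> X * Y} => ([ffun k => (f k).1], [ffun k => (f k).2])) => [[g h] _|f _] /=.
  by congr pair; apply/ffunP => k; rewrite !ffunE.
by apply/ffunP => k; rewrite !ffunE; case: (f k).
Qed.

Lemma sum_ord_pair d n (F : nat -> C) :
  \sum_(r < d * n) F r = \sum_(q : 'I_d * 'I_n) F (q.1 * n + q.2)%N.
Proof.
have lt (q : 'I_d * 'I_n) : (q.1 * n + q.2 < d * n)%N.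
  case: q => i a /=; apply: (@leq_trans (i * n + n)); first by rewrite ltn_add2l.
  by rewrite addnC -mulSn leq_mul2r ltn_ord orbT.
pose h q := Ordinal (lt q).
have hinj : injective h.
  move=> [i a] [j b] /(congr1 val) /= E.
  have n0 : (0 < n)%N by case: n a {lt h b E} => // -[].
  by congr pair; apply: val_inj; [have := congr1 (divn^~ n) E|have := congr1 (modn^~ n) E];
     rewrite /= ?divnMDl ?modnMDl ?divn_small ?modn_small ?addn0.
rewrite (reindex h) //; apply: onW_bij; apply: inj_card_bij => //.
by rewrite card_prod !card_ord.
Qed.

Variable J : finType.
Fixpoint fpow (M : J -> J -> C) k r s : C :=
  if k is k'.+1 then \sum_u fpow M k' r u * M u s else (r == s)%:R.

Lemma fpow_path (M : J -> J -> C) p r s : fpow M p.+1 r s =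
  \sum_(f : {ffun 'I_p.+1 -> J} | f ord0 == r)
     (\prod_(k < p) M (f (widen_ord (leqnSn p) k)) (f (lift ord0 k))) * M (f ord_max) s.
Proof.
elim: p s => [|p IH] s.
  rewrite /= (bigD1 r) //= eqxx mul1r big1 ?addr0; last first.
    by move=> u; rewrite eq_sym => /negbTE ->; rewrite mul0r.
  rewrite (big_pred1 [ffun=> r]) => [|f]; first by rewrite big_ord0 mul1r ffunE.
  apply/eqP/eqP => [E|->]; last by rewrite ffunE.
  by apply/ffunP => k; rewrite ffunE -E; congr (f _); apply: val_inj; case: k => [[]].
pose extf (fu : {ffun 'I_p.+1 -> J} * J) : {ffun 'I_p.+2 -> J} :=
  [ffun i => if unlift ord_max i is Some k then fu.1 k else fu.2].
have extW fu k : extf fu (widen_ord (leqnSn _) k) = fu.1 k.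
  rewrite ffunE (_ : widen_ord _ k = lift ord_max k) ?liftK //.
  by apply: val_inj; rewrite /= /bump leqNgt ltn_ord.
have extM fu : extf fu ord_max = fu.2 by rewrite ffunE unlift_none.
change (fpow M p.+2 r s) with (\sum_u fpow M p.+1 r u * M u s).
transitivity (\sum_u \sum_(f : {ffun 'I_p.+1 -> J} | f ord0 == r)
   (\prod_(k < p) M (f (widen_ord (leqnSn p) k)) (f (lift ord0 k)) * M (f ord_max) u) * M u s).
  by apply: eq_bigr => u _; rewrite IH big_distrl.
rewrite exchange_big pair_big_dep /= (reindex extf); last first.
  exists (fun g : {ffun 'I_p.+2 -> J} => ([ffun k => g (widen_ord (leqnSn _) k)], g ord_max)) => [[f u] _|g _].
    by congr pair; rewrite ?extM //; apply/ffunP => k; rewrite ffunE extW.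
  apply/ffunP => k; rewrite ffunE; case: unliftP => [j ->|->] //=.
  by rewrite ffunE; congr (g _); apply: val_inj; rewrite /= /bump leqNgt ltn_ord.
have w0 : ord0 = widen_ord (leqnSn _) ord0 :> 'I_p.+2 by apply: val_inj.
apply: eq_big => [fu|[f u] _]; first by rewrite w0 extW andbT.
rewrite extM /=; congr (_ * _); rewrite [RHS]big_ord_recr /=; congr (_ * _).
  apply: eq_bigr => k _; congr (M _ _).
    by rewrite extW.
  by rewrite (_ : lift ord0 (widen_ord _ k) = widen_ord (leqnSn _) (lift ord0 k)) ?extW //; apply: val_inj.
congr (M _ _); first by rewrite extW.
by rewrite (_ : lift ord0 ord_max = ord_max) ?extM //; apply: val_inj.
Qed.

Lemma fpow_trace (M : J -> J -> C) p :
  \sum_r fpow M p.+1 r r = \sum_(f : {ffun 'I_p.+1 -> J}) \prod_k M (f k) (f (rot1 p k)).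
Proof.
rewrite [RHS](partition_big (fun f : {ffun 'I_p.+1 -> J} => f ord0) predT) //; apply: eq_bigr => r _.
rewrite fpow_path; apply: eq_bigr => f /eqP fr; rewrite big_ord_recr /=; congr (_ * _).
  apply: eq_bigr => k _; congr (M _ (f _)); apply: val_inj; rewrite rot1_lt //=.
by rewrite -fr; congr (M _ (f _)); apply: val_inj; rewrite rot1_max.
Qed.

End Counting.

(** * The expected trace as a count of pairings *)

Section Trace.
Local Notation C := (R[i]).
Implicit Types (z : Cx) (x : nat -> R).

Definition toC z : C := Complex z.1 z.2.

Lemma toC_mul z w : toC (Cmul z w) = toC z * toC w.
Proof. by []. Qed.

Lemma toC_sum N f : toC (Csum N f) = \sum_(i < N) toC (f i).
Proof. by elim: N => [|N IH]; rewrite ?big_ord0 // big_ord_recr -IH. Qed.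

Lemma toC_scale (r : R) z : toC (Cscale r z) = r%:C * toC z.
Proof. by case: z => a b; apply/eqP; rewrite eq_complex /= !mul0r subr0 addr0 !eqxx. Qed.

Section Encoding.
Variables (d n : nat).
Implicit Types q : 'I_d * 'I_n.

Lemma toC_mpow (A : cmat) k q q' :
  toC (mpow (d * n) A k (q.1 * n + q.2)%N (q'.1 * n + q'.2)%N) =
  fpow (fun u u' : 'I_d * 'I_n => toC (A (u.1 * n + u.2)%N (u'.1 * n + u'.2)%N)) k q q'.
Proof.
elim: k q' => [|k IH] q' /=.
  rewrite /mid; have -> : Nat.eqb (q.1 * n + q.2)%N (q'.1 * n + q'.2)%N = (q == q').
    apply/PeanoNat.Nat.eqb_spec/eqP => [E|-> //].
    case: q q' E => [i a] [j b] /= E; congr pair; apply: val_inj => /=.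
      by have := congr1 (divn^~ n) E; rewrite /= !divnMDl ?divn_small ?addn0 //; case: n a b {E} => // -[].
    by have := congr1 (modn^~ n) E; rewrite /= !modnMDl ?modn_small.
  by case: eqP.
rewrite /mmul toC_sum (sum_ord_pair _ _ (fun u => toC (Cmul (mpow (d * n) A k (q.1 * n + q.2)%N u) (A u (q'.1 * n + q'.2)%N)))).
by apply: eq_bigr => u _; rewrite toC_mul IH.
Qed.

End Encoding.

Lemma Nat_divE a b : Nat.div a b = (a %/ b)%N.
Proof.
case: b => [|b]; first by rewrite divn0.
by apply/esym/(PeanoNat.Nat.div_unique _ _ _ (a %% b.+1)%N); [apply/ltP; rewrite ltn_mod|rewrite {1}(divn_eq a b.+1) mulnC].
Qed.

Lemma Nat_moduloE a b : (0 < b)%N -> Nat.modulo a b = (a %% b)%N.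
Proof.
by case: b => // b _; apply/esym/(PeanoNat.Nat.mod_unique _ _ (a %/ b.+1)%N); [apply/ltP; rewrite ltn_mod|rewrite {1}(divn_eq a b.+1) mulnC].
Qed.

Lemma letter_Gent x b cols r l :
  letter x (b, r * cols + l)%N = if b then (toC (Gent x cols r l))^* else toC (Gent x cols r l).
Proof.
have E2 : IZR 2 = 2%:R by [].
rewrite /letter /Gent /toC /inv_sqrt2 !RdivE E2 RsqrtE ?ler0n //=.
by rewrite addn1; case: b.
Qed.

Variables (d n m : nat).
Hypotheses (d0 : (0 < d)%N) (n0 : (0 < n)%N) (m0 : (0 < m)%N).

Definition entry_index (i : 'I_d) (a : 'I_n) (l : 'I_(d * m)) := ((i * n + a) * (d * m) + l)%N.

Lemma entry_index_lt i a l : ((2 * entry_index i a l).+1 < 2 * (d * n) * (d * m))%N.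
Proof.
have : (entry_index i a l < (d * n) * (d * m))%N; last by lia.
rewrite /entry_index; apply: (@leq_trans ((i * n + a) * (d * m) + d * m)); first by rewrite ltn_add2l.
rewrite addnC -mulSn leq_mul2r; apply/orP; right.
apply: (@leq_trans (i * n + n)); first by rewrite ltn_add2l.
by rewrite addnC -mulSn leq_mul2r ltn_ord orbT.
Qed.

Lemma entry_index_eq i a l j b k :
  (entry_index i a l == entry_index j b k) = [&& i == j, a == b & l == k].
Proof.
apply/eqP/and3P => [E|[/eqP -> /eqP -> /eqP ->] //].
have dm0 : (0 < d * m)%N by rewrite muln_gt0 d0.
have E1 : (i * n + a = j * n + b)%N.
  by have := congr1 (divn^~ (d * m)%N) E; rewrite /entry_index /= !divnMDl // !divn_small // !addn0.
split; apply/eqP/val_inj => /=.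
- by have := congr1 (divn^~ n) E1; rewrite /= !divnMDl // !divn_small // !addn0.
- by have := congr1 (modn^~ n) E1; rewrite /= !modnMDl !modn_small.
by have := congr1 (modn^~ (d * m)%N) E; rewrite /entry_index /= !modnMDl !modn_small.
Qed.

(** The partial transpose exchanges [q.2] and [q'.2]; the scalar is [m / (d m) = 1 / d]. *)
Lemma toC_entry x (q q' : 'I_d * 'I_n) :
  toC (Cscale (INR m) (partial_transpose n (wishart d n m x) (q.1 * n + q.2)%N (q'.1 * n + q'.2)%N)) =
  (d%:R)^-1 * \sum_(l < d * m) letter x (false, entry_index q.1 q'.2 l) * letter x (true, entry_index q'.1 q.2 l).
Proof.
rewrite /partial_transpose !Nat_divE.
case: q q' => [i a] [j b] /=.
rewrite !Nat_moduloE // !divnMDl // !modnMDl !divn_small // !modn_small // !addn0.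
rewrite toC_scale /wishart toC_scale toC_sum mulrA; congr (_ * _).
  have -> : (INR m)%:C = m%:R :> C by rewrite INRE rmorph_nat.
  have -> : (Rinv (INR (Nat.mul d m)))%:C = ((d * m)%:R)^-1 :> C by rewrite INRE RinvE fmorphV rmorph_nat.
  rewrite natrM invfM mulrCA divff ?mulr1 // pnatr_eq0 -lt0n //.
by apply: eq_bigr => l _; rewrite toC_mul /entry_index !letter_Gent.
Qed.

Variable p : nat.
Local Notation g := (rot1 p).
Local Notation P := ('I_p.+1).

Lemma toC_moment_sample x : toC (moment_sample d n m p.+1 x) =
  ((d * n)%:R * d%:R ^+ p.+1)^-1 * \sum_(f : {ffun P -> 'I_d * 'I_n}) \sum_(l : {ffun P -> 'I_(d * m)})
  \prod_(c <- [seq (false, entry_index (f k).1 (f (g k)).2 (l k)) | k <- enum P] ++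
              [seq (true, entry_index (f (g k)).1 (f k).2 (l k)) | k <- enum P]) letter x c.
Proof.
rewrite /moment_sample /ntr toC_scale toC_sum.
set X := (fun r s => Cscale _ _).
rewrite (sum_ord_pair _ _ (fun r => toC (mpow (d * n) X p.+1 r r))).
have -> : \sum_(q : 'I_d * 'I_n) toC (mpow (d * n) X p.+1 (q.1 * n + q.2)%N (q.1 * n + q.2)%N) =
  \sum_q fpow (fun u u' : 'I_d * 'I_n => toC (X (u.1 * n + u.2)%N (u'.1 * n + u'.2)%N)) p.+1 q q.
  by apply: eq_bigr => q _; rewrite toC_mpow.
rewrite fpow_trace invfM -mulrA; congr (_ * _).
  by rewrite INRE RinvE fmorphV rmorph_nat.
rewrite big_distrr; apply: eq_bigr => f _.
under eq_bigr => k _ do rewrite toC_entry.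
rewrite big_split /= prodr_const card_ord exprVn; congr (_ * _).
rewrite bigA_distr_bigA /=; apply: eq_bigr => l _.
by rewrite big_cat !big_map -!enumT !big_enum big_split.
Qed.

(** [s] pairs the plain letter of factor [k] with the conjugate letter of factor [s k]. Equal
    entries force the [d]-coordinates to be constant on cycles of [s * g], the [n]-coordinates on
    those of [g^-1 * s] and the column indices on those of [s]. *)
Definition pairing_count :=
  (\sum_(s : {perm P}) d ^ ncycles (s * g) * n ^ ncycles (g^-1 * s) * (d * m) ^ ncycles s)%N.

Lemma has_moment_moment_sample :
  has_moment (2 * (d * n) * (d * m)) (fun x => toC (moment_sample d n m p.+1 x))
    (((d * n)%:R * d%:R ^+ p.+1)^-1 * pairing_count%:R : C).
Proof.
apply: has_moment_ext (fun x => esym (toC_moment_sample x)) _.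
apply: has_moment_scale.
have -> : pairing_count%:R =
  \sum_(f : {ffun P -> 'I_d * 'I_n}) \sum_(l : {ffun P -> 'I_(d * m)})
   wick (2 * (d * n) * (d * m)) ([seq (false, entry_index (f k).1 (f (g k)).2 (l k)) | k <- enum P] ++
              [seq (true, entry_index (f (g k)).1 (f k).2 (l k)) | k <- enum P]) :> C.
  rewrite natr_sum.
  transitivity (\sum_(f : {ffun P -> 'I_d * 'I_n}) \sum_(l : {ffun P -> 'I_(d * m)}) \sum_(s : {perm P})
     \prod_k (entry_index (f k).1 (f (g k)).2 (l k) == entry_index (f (g (s k))).1 (f (s k)).2 (l (s k)))%:R : C);
    last first.
    apply: eq_bigr => f _; apply: eq_bigr => l _; rewrite wick_permanent // => k; exact: entry_index_lt.
  rewrite sum_ffun_pair.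
  transitivity (\sum_(s : {perm P}) \sum_(h : {ffun P -> 'I_d}) \sum_(h' : {ffun P -> 'I_n}) \sum_(l : {ffun P -> 'I_(d * m)})
    (\prod_k (h k == h ((s * g)%g k))%:R * \prod_k (h' k == h' ((g^-1 * s)%g k))%:R * \prod_k (l k == l (s k))%:R) : C).
    apply: eq_bigr => s _.
    have S k (t : {perm P}) : (k ^ ncycles t)%:R = \sum_(h : {ffun P -> 'I_k}) \prod_i (h i == h (t i))%:R :> C.
      by rewrite sum_porbits_invariant card_ord.
    rewrite !natrM !S.
    rewrite -mulrA big_distrl; apply: eq_bigr => h _.
    rewrite big_distrl big_distrr; apply: eq_bigr => h' _.
    by rewrite big_distrr big_distrr /=; apply: eq_bigr => l _; rewrite mulrA.
  rewrite exchange_big; apply: eq_bigr => h _; rewrite exchange_big; apply: eq_bigr => h' _.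
  rewrite exchange_big; apply: eq_bigr => l _; apply: eq_bigr => s _.
  (* The pairing reads [h' (g k) = h' (s k)], which is invariance under [g^-1 * s] after the shift
     by [g]. *)
  rewrite [X in _ * X * _](reindex_perm g) -!big_split; apply: eq_bigr => k _ /=.
  rewrite entry_index_eq !ffunE /= !permM permK -!natrM !mulnb.
  by rewrite andbA.
refine (@has_moment_sum _ _ _ _ _ _) => f; refine (@has_moment_sum _ _ _ _ _ _) => l; exact: has_moment_letters.
Qed.

End Trace.

(** * The limit *)

Lemma expected_momentE d n m p : (0 < d)%N -> (0 < n)%N -> (0 < m)%N ->
  expected_moment_re d n m p.+1 = ((d * n)%:R * d%:R ^+ p.+1)^-1 * (pairing_count d n m p)%:R /\
  expected_moment_im d n m p.+1 = 0.
Proof.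
move=> d0 n0 m0; have := has_moment_expect (has_moment_moment_sample d0 n0 m0 p).
pose r := ((d * n)%:R * d%:R ^+ p.+1)^-1 * (pairing_count d n m p)%:R : Num.NumDomain.sort R.
have -> : ((d * n)%:R * d%:R ^+ p.+1)^-1 * (pairing_count d n m p)%:R = r%:C :> R[i].
  by rewrite /r !natrM rmorphM fmorphV !rmorphM rmorphXn !rmorph_nat.
by [].
Qed.

Lemma Un_cv_big_sum (J : Type) (r : seq J) (u : J -> nat -> R) (l : J -> R) :
  (forall j, Un_cv (u j) (l j)) -> Un_cv (fun k => \sum_(j <- r) u j k) (\sum_(j <- r) l j).
Proof.
move=> h; elim: r => [|j r IH].
  by rewrite big_nil; apply: (Un_cv_ext (fun _ => 0)) => [k|]; [rewrite big_nil|apply: Un_cv_const].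
by rewrite big_cons; apply: Un_cv_ext (CV_plus _ _ _ _ (h j) IH) => k; rewrite big_cons.
Qed.

Lemma Un_cv_scale (c : R) (u : nat -> R) l : Un_cv u l -> Un_cv (fun k => c * u k) (c * l).
Proof. by move=> h; apply: (CV_mult (fun _ => c)) => //; apply: Un_cv_const. Qed.

Lemma ncycles_gt0 q (s : {perm 'I_q.+1}) : (0 < ncycles s)%N.
Proof. by apply/card_gt0P; exists (porbit s ord0); apply: imset_f. Qed.

(** The [n] of the normalized trace cancels one cycle of [g^-1 * s]; [d^(q+2)] collects the trace
    and the [q + 1] factors. *)
Lemma normalized_term (F : fieldType) (d n m : F) a b c q : d != 0 -> n != 0 ->
  m ^+ a * n ^+ b * (d ^+ (c + a) / d ^+ q.+2) =
  (d * n * d ^+ q.+1)^-1 * (d ^+ c * n ^+ b.+1 * (d ^+ a * m ^+ a)).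
Proof.
move=> d0 n0; have dq : d ^+ q.+1 != 0 by rewrite expf_neq0.
by rewrite exprD [d ^+ q.+2]exprS [n ^+ b.+1]exprS; field; rewrite d0 n0 dq.
Qed.

Lemma Un_cv_expected_moment_re n m p : (0 < n)%N -> (0 < m)%N ->
  Un_cv (fun k => expected_moment_re k.+1 n m p.+1) (nc_moment n m p.+1)%:R.
Proof.
move=> n0 m0; pose g := rot1 p.
pose c (s : {perm 'I_p.+1}) := (m ^ ncycles s * n ^ (ncycles (g^-1 * s)%g).-1)%N.
pose e (s : {perm 'I_p.+1}) := (ncycles (s * g)%g + ncycles s)%N.
have -> : (nc_moment n m p.+1)%:R = \sum_(s : {perm 'I_p.+1}) (c s)%:R * (e s == p.+2)%:R :> Num.NumDomain.sort R.
  (* For [t = s^-1], geodesicity reads [#(s g) + #s = p + 2], and [#(g t) = #(g^-1 s)] by inversion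
     and conjugation. *)
  rewrite nc_moment_geodesic natr_sum big_mkcond [RHS](reindex_inj invg_inj).
  apply: eq_bigr => s _; rewrite /c /e /geodesic mulKVg ncycles_rot1 card_ord addn1.
  rewrite ncyclesV addnC -invMg ncyclesV [ncycles (s * _)%g]ncyclesC.
  by case: eqP; rewrite ?mulr1 ?mulr0.
pose u (s : {perm 'I_p.+1}) k := (c s)%:R * (k.+1%:R ^+ e s / k.+1%:R ^+ p.+2) : Num.NumDomain.sort R.
apply: (Un_cv_ext (fun k => \sum_s u s k)) => [k|].
  have [-> _] := expected_momentE p (ltn0Sn k) n0 m0.
  rewrite /pairing_count natr_sum big_distrr; apply: eq_bigr => s _ /=.
  rewrite /u /c /e !natrM !natrX natrM exprMn -/g -{2}(prednK (ncycles_gt0 (g^-1 * s)%g)).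
  by apply: normalized_term; rewrite pnatr_eq0 // -lt0n.
apply: Un_cv_big_sum => s; apply: Un_cv_scale.
have le : (e s <= p.+2)%N.
  have := ncycles_genus s^-1%g (s * g)%g.
  by rewrite mulKg ncyclesV ncycles_rot1 card_ord addn1 addnC.
have [->|ne] := eqVneq (e s) p.+2.
  apply: (Un_cv_ext (fun _ => 1)) => [k|]; last exact: Un_cv_const.
  by rewrite divff // expf_neq0 // pnatr_eq0.
apply: Un_cv_ext (Un_cv_pow_ratio (e s) p.+2 _) => [k|]; last by apply/ltP; rewrite ltn_neqAle ne.
by rewrite RdivE !RpowE INRE.
Qed.

Theorem theorem1p2 (n m : nat) (hn : (0 < n)%nat) (hm : (0 < m)%nat)
  (p : nat) (hp : (1 <= p)%nat) :
  Un_cv (fun k => expected_moment_re k.+1 n m p) (INR (nc_moment n m p)) /\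
  Un_cv (fun k => expected_moment_im k.+1 n m p) 0%R.
Proof.
case: p hp => // p _; split; first by rewrite INRE; apply: Un_cv_expected_moment_re.
apply: (Un_cv_ext (fun _ => 0)) => [k|]; last exact: Un_cv_const.
by have [_ ->] := expected_momentE p (ltn0Sn k) hn hm.
Qed.
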